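(* Let $(\Omega_d,\rho_d,\mu_d)_{d\in\mathbb N}$ be a family of metric spaces with probability measures having concentration dimension $\Theta(d)$, i.e. $\alpha_{\Omega_d}(\varepsilon)=\exp(-\Theta(\varepsilon^2 d))$, and with expected distance between two random points $\mathbb{E}\,\rho_d(x,y)=1$. Let $\mathscr F=\mathscr F_d$ be the class of all $1$-Lipschitz functions on $\Omega_d$ that can be used as decision functions for metric tree indexing schemes of a given type, and suppose $\mathrm{VC\text{-}dim}(\mathscr F_{\ge})$ is polynomial in $d$. Let $X$ be an i.i.d. random sample of $\Omega_d$ according to $\mu_d$ with $n$ points, where $d=n^{o(1)}$ and $d=\omega(\log n)$. Then, with confidence asymptotically approaching $1$, an optimal metric tree indexing scheme (with decision functions from $\mathscr F$) for the similarity workload $(\Omega_d,\rho_d,X)$ has expected average performance $d^{\omega(1)}$; that is, the average (over query points $\omega\sim\mu_d$) search time for an exact nearest neighbour of $\omega$ in $X$ is superpolynomial in $d$.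
   Context: Concentration function of $(\Omega,\rho,\mu)$: $\alpha_\Omega(0)=1/2$ and for $\varepsilon>0$, $\alpha_\Omega(\varepsilon)=1-\min\{\mu(A_\varepsilon)\colon \mu(A)\ge1/2\}$ with $A_\varepsilon=\{x\colon\rho(x,A)<\varepsilon\}$. For a class $\mathscr F$ of (possibly partially defined) real functions, $\mathscr F_\ge$ is the family of sets $\{\omega\in\mathrm{dom}f\colon f(\omega)\ge a\}$, $f\in\mathscr F$, $a\in\mathbb R$; VC dimension is the usual Vapnik–Chervonenkis dimension (largest cardinality of a set shattered by the family). A metric tree for the workload $(\Omega,\rho,X)$: a finite binary rooted tree, sets $B_t\subseteq\Omega$ for nodes $t$ with $B_{\mathrm{root}}=\Omega$, and for each internal node $t$ with children $t_-,t_+$ a $1$-Lipschitz decision function $f_t\colon B_t\to\mathbb R$ with $B_t\subseteq B_{t_-}\cup B_{t_+}$, $f_t\le0$ on $B_{t_-}$, $f_t\ge0$ on $B_{t_+}$; leaves carry bins $B_t$ with pointers to $X\cap B_t$. A range query ${\mathcal B}_\varepsilon(\omega)=\{x\colon\rho(\omega,x)<\varepsilon\}$ is answered by traversing the tree from the root: at internal node $t$, $t_-$ is visited iff $f_t(\omega)<\varepsilon$ and $t_+$ is visited iff $f_t(\omega)>-\varepsilon$; at each visited leaf every $x\in X\cap B_t$ is checked for $\rho(\omega,x)<\varepsilon$. Exact nearest neighbour search for $\omega$ is the range query of radius $\varepsilon_{NN}(\omega)=\min_{x\in X}\rho(\omega,x)$; its cost counts at least one operation per visited bin. Expected average performance is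 the expected cost over $\omega\sim\mu_d$ (query points have the same distribution as data). ''Confidence approaching 1'' refers to the probability over the random samples, independent in each $\Omega_d$, tending to $1$ as $d\to\infty$.
   Formalization: Each measure is assumed Borel and carried by a separable closed subset (automatic for separable spaces; without it the claim can fail if measurable cardinals exist), and decision functions are defined on all of the space, since queries outside a bin evaluate them. *)

(* Defs.v *)
From HB Require Import structures.
From mathcomp Require Import all_boot all_order all_algebra.
From mathcomp Require Import all_classical all_reals all_analysis.

Set Implicit Arguments.
Unset Strict Implicit.
Unset Printing Implicit Defensive.

Import Order.TTheory GRing.Theory Num.Theory.
Import numFieldNormedType.Exports.

Local Open Scope classical_set_scope.
Local Open Scope ring_scope.

(* Measurable types are pointed in the library; a space carrying a probability
   measure is nonempty, so pointedness is no restriction. *)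
#[short(type="pmetricType")]
HB.structure Definition PMetric (K : numDomainType) :=
  { M of Pointed M & Metric K M }.

Definition borel (R : realType) (T : pmetricType R) :=
  g_sigma_algebraType (@open T).

Section MetricMeasureSpaces.
Context (R : realType) (T : pmetricType R).
Implicit Types (A D : set T) (x : T) (e : R) (f : T -> R)
  (mu : probability (borel T) R).

Definition dist_to A x : R := inf [set mdist x a | a in A].

Definition nbhd A e : set T := [set x | dist_to A x < e].

Definition conc_fun mu e : \bar R :=
  if e == 0 then (2^-1)%:E
  else (1 - ereal_inf [set mu (nbhd A e) |
              A in [set A : set (borel T) |
                      measurable A /\ ((2^-1)%:E <= mu A)%E]])%E.

(* The usual regularity of a probability measure on a metric space: it is
   carried by a separable closed subset. Automatic if T is separable. *)
Definition separably_supported mu :=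
  exists2 D, countable D & mu (closure D) = 1%E.

(* Iterated, so that no measurability of mdist for the product sigma-algebra is
   needed. *)
Definition expected_dist mu : \bar R :=
  (\int[mu]_x \int[mu]_y (mdist (x : T) (y : T))%:E)%E.

Definition lipschitz1 f := forall x y, `|f x - f y| <= mdist x y.

Definition upper_sets (F : set (T -> R)) : set (set T) :=
  [set C | exists f a, F f /\ C = [set x | a <= f x]].

End MetricMeasureSpaces.

Section VapnikChervonenkis.
Context (R : realType) (T : Type).

Definition shatters (C : set (set T)) (A : set T) :=
  forall B, B `<=` A -> exists2 S, C S & A `&` S = B.

Definition vc_dim (C : set (set T)) : \bar R :=
  ereal_sup [set m%:R%:E | m in
    [set m : nat | exists A : set T, (A #= `I_m)%card /\ shatters C A]].

End VapnikChervonenkis.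

(* -ln (conc_fun (mu d) e) = Theta (e ^ 2 * d), as e ^ 2 * d grows. For
   e ^ 2 * d near 0 the second bound cannot hold, as conc_fun <= 1 / 2; for e
   beyond the diameter conc_fun is 0, so it is only required up to a constant
   e0. *)
Definition concentration_dim_Theta (R : realType) (T : nat -> pmetricType R)
    (mu : forall d, probability (borel (T d)) R) :=
  exists c1 c2 e0 K : R, [/\ 0 < c1, 0 < c2, 0 < e0 &
    \forall d \near \oo, forall e : R, 0 < e -> K <= e ^+ 2 * d%:R ->
      (conc_fun (mu d) e <= (expR (- (c1 * (e ^+ 2 * d%:R))))%:E)%E /\
      (e <= e0 ->
         ((expR (- (c2 * (e ^+ 2 * d%:R))))%:E <= conc_fun (mu d) e)%E)].

Section Samples.
Context (R : realType) (T : pmetricType R) (dW : measure_display)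
  (W : measurableType dW).

(* Taking some of the A i to be setT gives the product rule for subfamilies. *)
Definition iid_sample (P : probability W R) (mu : probability (borel T) R)
    (n : nat) (X : 'I_n -> W -> T) :=
  [/\ forall i, measurable_fun [set: W] (X i : W -> borel T),
      forall i (A : set (borel T)), measurable A -> P (X i @^-1` A) = mu A &
      forall A : 'I_n -> set (borel T), (forall i, measurable (A i)) ->
        P (\bigcap_i (X i @^-1` A i)) = (\prod_(i < n) P (X i @^-1` A i))%E].

End Samples.

Section MetricTrees.
Context (R : realType) (T : pmetricType R).

Inductive mtree :=
| Leaf of set T
| Node of set T & (T -> R) & mtree & mtree.

Definition bin (t : mtree) : set T :=
  match t with Leaf B => B | Node B _ _ _ => B end.

Fixpoint mtree_wf (F : set (T -> R)) (t : mtree) : Prop :=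
  match t with
  | Leaf _ => True
  | Node B f l r =>
      [/\ F f, B `<=` bin l `|` bin r,
          (forall x, bin l x -> f x <= 0) & (forall x, bin r x -> 0 <= f x)]
      /\ mtree_wf F l /\ mtree_wf F r
  end.

Definition metric_tree (F : set (T -> R)) : set mtree :=
  [set t | bin t = setT /\ mtree_wf F t].

Context (n : nat) (X : 'I_n -> T).

(* One operation for each visited node (evaluating the decision function, or
   opening the leaf bin) and one for each distance check in a visited leaf. *)
Fixpoint query_cost (t : mtree) (w : T) (e : R) : nat :=
  match t with
  | Leaf B => 1 + #|[pred i | X i \in B]|
  | Node _ f l r => 1 + (if (f w < e)%R then query_cost l w e else 0)
                      + (if (- e < f w)%R then query_cost r w e else 0)
  end%N.

Definition nn_radius (w : T) : R := inf (range (fun i => mdist w (X i))).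

Definition average_cost (mu : probability (borel T) R) (t : mtree) : \bar R :=
  (\int[mu]_w (query_cost t w (nn_radius w))%:R%:E)%E.

Definition optimal_cost (mu : probability (borel T) R) (F : set (T -> R)) :
    \bar R :=
  ereal_inf [set average_cost mu t | t in metric_tree F].

End MetricTrees.

(* The events G d need not be measurable: it is their inner probability that
   tends to 1. *)
Definition with_confidence_to_1 (R : realType) (dW : nat -> measure_display)
    (W : forall d, measurableType (dW d)) (P : forall d, probability (W d) R)
    (G : forall d, set (W d)) :=
  exists E : forall d, set (W d),
    (forall d, measurable (E d) /\ E d `<=` G d) /\
    P d (E d) @[d --> \oo] --> 1%E.

(* Main.v *)
(* Fix eps = 1/8 and write b = exp (- c d) for the bound that concentration
   gives at scale 1/24. Since distances have mean 1, no ball of radius 1/4 has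
   measure 1/2, so every ball of radius 1/8 has measure at most b; as n is
   exp (o(d)), the nearest neighbour radius is at least 1/8 off a set of
   measure n b. A decision function f either is within eps of 0 off a set of
   measure 2 b, and then almost every query visits both children, or has a
   constant sign off a set of measure b. In the second case almost every query
   visits the child of that sign, and the other child holds at most
   k = poly(d) data points: all of them lie in a set of measure at most b from
   a class of polynomial VC dimension, and symmetrization bounds the number of
   sample points in all such sets at once. Discarding at most k points at each
   visited node, a budget of n nodes suffices to see that (k + 1) * cost is at
   least n for half of the queries, and n / (2 (k + 1)) is superpolynomial
   in d. *)
Require Import Defs.
From mathcomp Require Import all_boot all_order all_algebra.
From mathcomp Require Import zify ring lra.

Set Implicit Arguments.
Unset Strict Implicit.
Unset Printing Implicit Defensive.

Import Order.TTheory GRing.Theory Num.Theory.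

(** * Sauer-Shelah *)

Section FiniteShattering.
Variable I : finType.
Implicit Types (G : {set {set I}}) (A B S : {set I}).

(** A boolean, so that shattered sets can be collected in a finite set and counted. *)
Definition fshatters G A :=
  [forall B : {set I}, (B \subset A) ==> [exists S in G, A :&: S == B]].

Lemma fshattersP G A :
  reflect (forall B, B \subset A -> exists2 S, S \in G & A :&: S = B)
    (fshatters G A).
Proof.
apply: (iffP forallP) => [h B BA|h B].
  by have /implyP/(_ BA)/exists_inP[S SG /eqP] := h B; exists S.
by apply/implyP => /h[S SG <-]; apply/exists_inP; exists S.
Qed.

Lemma fshattersS G G' A : G \subset G' -> fshatters G A -> fshatters G' A.
Proof.
move=> /subsetP GG' /fshattersP h; apply/fshattersP => B /h[S /GG' SG eB].
by exists S.
Qed.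

(* Pajor's inequality, by splitting G according to membership of a point x that
   is in some but not all members: a set shattered by both halves remains
   shattered by G after adding x. *)
Lemma card_le_fshatters G : (#|G| <= #|[set A | fshatters G A]|)%N.
Proof.
have [m] := ubnP #|G|; elim: m G => // m IH G; rewrite ltnS => Gm.
have [G1|G1] := leqP #|G| 1.
  case: (posnP #|G|) => [->|G0]; first exact: leq0n.
  apply: leq_trans G1 _.
  have [S SG] := card_gt0P G0.
  apply/card_gt0P; exists set0; rewrite inE; apply/fshattersP => B.
  by rewrite subset0 => /eqP ->; exists S; rewrite ?set0I.
have [S1 [S2 [S1G S2G S12]]] := card_gt1P G1.
have [x xS] : exists x, x \in (S1 :\: S2) :|: (S2 :\: S1).
  apply/set0Pn; apply: contra_neq S12 => /eqP.
  rewrite setU_eq0 !setD_eq0 => S12; apply/eqP; by rewrite eqEsubset.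
pose H b := [set S in G | (x \in S) == b].
have Hne b : exists2 S, S \in G & (x \in S) != b.
  move: xS; rewrite !inE; case: b => /orP[]/andP[h1 h2].
  - by exists S2 => //; rewrite (negbTE h1).
  - by exists S1 => //; rewrite (negbTE h1).
  - by exists S1 => //; rewrite h2.
  - by exists S2 => //; rewrite h2.
have Hlt b : (#|H b| < #|G|)%N.
  apply: proper_card; apply/properP; split.
    by apply/subsetP => S; rewrite inE => /andP[].
  by have [S SG xSb] := Hne b; exists S; rewrite // inE SG.
have Hsub b : H b \subset G by apply/subsetP => S; rewrite inE => /andP[].
have IHb b : (#|H b| <= #|[set A | fshatters (H b) A]|)%N.
  by apply: IH; apply: leq_trans (Hlt b) Gm.
(* All members of [H b] agree at [x], so a set containing [x] has a subset that they cannot cut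
   out. *)
have xN b A : fshatters (H b) A -> x \notin A.
  move=> /fshattersP h; apply/negP => xA.
  have [|S] := h (if b then set0 else [set x]).
    by case: b {h}; rewrite ?sub0set// sub1set.
  rewrite inE => /andP[_ /eqP xSb] /setP/(_ x).
  by rewrite inE xA xSb; case: b {h xSb}; rewrite !inE ?eqxx.
have -> : #|G| = (#|H true| + #|H false|)%N.
  rewrite -(cardsID (H true) G); congr (_ + _)%N; apply: eq_card => S.
    by rewrite !inE; case: (S \in G).
  by rewrite !inE; case: (S \in G); case: (x \in S).
apply: leq_trans (leq_add (IHb true) (IHb false)) _.
set X := [set A | _ (H true) A]; set Y := [set A | _ (H false) A].
rewrite -cardsUI.
have <- : #|[set x |: A | A in X :&: Y]| = #|X :&: Y|.
  apply: card_in_imset => A B; rewrite !inE => /andP[/xN xA _] /andP[/xN xB _].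
  by move=> /(congr1 (fun Z => Z :\ x)); rewrite !setU1K.
have dis : [disjoint X :|: Y & [set x |: A | A in X :&: Y]].
  apply/pred0P => A /=; apply/negP => /andP[].
  rewrite !inE => AXY /imsetP[B _ AB].
  have : x \in A by rewrite AB setU11.
  by case/orP: AXY => /xN /negbTE ->.
have <- : #|(X :|: Y) :|: [set x |: A | A in X :&: Y]| =
    (#|X :|: Y| + #|[set x |: A | A in X :&: Y]|)%N.
  apply/eqP.
  by have [_ ->] := leq_card_setU (X :|: Y) [set x |: A | A in X :&: Y].
apply: subset_leq_card; apply/subsetP => A; rewrite !inE => /orP[|].
  by case/orP; apply: fshattersS.
case/imsetP => B; rewrite !inE => /andP[hT hF] ->.
apply/fshattersP => C CB.
(* A trace containing [x] comes from a member of [H true], one avoiding [x] from a member of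
   [H false]. *)
have [xC|xC] := boolP (x \in C).
  have [|S] := (fshattersP _ _ hT) (C :\ x); first by rewrite subDset.
  rewrite inE => /andP[SG /eqP xS'] BS; exists S => //.
  by rewrite setIUl BS (setIidPl _) ?sub1set// setD1K.
have [|S] := (fshattersP _ _ hF) C.
  apply/subsetP => y yC; have := subsetP CB y yC.
  by rewrite !inE => /orP[/eqP yx|//]; rewrite -yx yC in xC.
rewrite inE => /andP[SG /eqP xS'] BS; exists S => //.
rewrite setIUl BS (_ : [set x] :&: S = set0) ?set0U//.
by apply/setP => y; rewrite !inE; apply/negP => /andP[/eqP ->]; rewrite xS'.
Qed.

(** Listing the elements of a small set and padding the list with [None] codes the set by a function
    from ['I_D] to [option I]. *)
Lemma card_sets_le (D : nat) :
  (#|[set A : {set I} | #|A| <= D]| <= #|I|.+1 ^ D)%N.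
Proof.
pose h (f : {ffun 'I_D -> option I}) := [set x | Some x \in codom f].
have -> : (#|I|.+1 ^ D)%N = #|{ffun 'I_D -> option I}|.
  by rewrite card_ffun card_option card_ord.
apply: leq_trans (leq_imset_card h predT).
apply: subset_leq_card; apply/subsetP => A; rewrite inE => AD.
apply/imsetP; exists [ffun i : 'I_D => nth None (map some (enum A)) i] => //.
apply/setP => x; rewrite inE; apply/idP/codomP => [xA|[i]].
  have xi : (index x (enum A) < D)%N.
    by apply: leq_trans AD; rewrite cardE index_mem mem_enum.
  exists (Ordinal xi); rewrite ffunE /= (nth_map x) ?nth_index ?mem_enum//.
  by rewrite index_mem mem_enum.
rewrite ffunE; have [iA|iA] := ltnP i (size (enum A)).
  by rewrite (nth_map x)// => -[->]; rewrite -(mem_enum A) mem_nth.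
by rewrite nth_default// size_map.
Qed.

(** Pajor's inequality followed by a count of all small sets. The crude power in place of the sum of
    binomial coefficients is enough for what follows. *)
Lemma sauer_shelah G (D : nat) :
  (forall A, fshatters G A -> (#|A| <= D)%N) -> (#|G| <= #|I|.+1 ^ D)%N.
Proof.
move=> GD; apply: leq_trans (card_le_fshatters G) _.
apply: leq_trans (card_sets_le D); apply: subset_leq_card.
by apply/subsetP => A; rewrite !inE; apply: GD.
Qed.

End FiniteShattering.

(* With t the trace of a set on a double sample, the two conditions force the
   swap s at the indices where t is nonempty, and there are at least k of
   these. *)
Lemma card_swaps n k (t : {set bool * 'I_n}) :
  (#|[set s : {ffun 'I_n -> bool} | (k <= #|[set i | (s i, i) \in t]|)%N &&
        [forall i, (~~ s i, i) \notin t]]| * 2 ^ k <= 2 ^ n)%N.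
Proof.
pose S := [set i | ((true, i) \in t) || ((false, i) \in t)].
have [kS|Sk] := leqP k #|S|; last first.
  rewrite (_ : [set s | _] = set0) ?cards0 ?mul0n//.
  apply/setP => s; rewrite !inE; apply/negP => /andP[ks _].
  move: Sk; rewrite ltnNge => /negP; apply; apply: leq_trans ks _.
  apply: subset_leq_card; apply/subsetP => i; rewrite !inE.
  by case: (s i) => ->; rewrite ?orbT.
(* The values allowed at [i]: one if [i] is in [S], both otherwise. This leaves [2 ^ (n - #|S|)]
   swaps. *)
pose fam (i : 'I_n) : pred bool :=
  fun b => (i \in S) ==> (b == ((true, i) \in t)).
apply: (@leq_trans (#|family fam| * 2 ^ k)).
  rewrite leq_mul2r; apply/orP; right.
  apply: subset_leq_card; apply/subsetP => s.
  rewrite inE => /andP[_ /forallP h].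
  apply/familyP => i; rewrite unfold_in /fam; apply/implyP; rewrite inE.
  by have := h i; case: (s i) => /= /negbTE ->; rewrite ?orbF ?orbT// => ->.
rewrite card_family.
have -> : foldr muln 1%N [seq #|fam x| | x : 'I_n] = \prod_(i < n) #|fam i|.
  by rewrite foldrE big_map big_enum.
rewrite (bigID (mem S))/= big1 ?mul1n; last first.
  move=> i iS; rewrite -(card1 ((true, i) \in t)); apply: eq_card => b.
  by rewrite [LHS]unfold_in /fam iS !inE.
rewrite (eq_bigr (fun=> 2%N)) => [|i iS]; last first.
  rewrite -card_bool; apply: eq_card => b.
  by rewrite [LHS]unfold_in /fam (negbTE iS).
rewrite prod_nat_const.
have -> : #|[pred i | i \notin S]| = (n - #|S|)%N.
  have cS : (#|S| + #|[predC S]| = n)%N by rewrite cardC card_ord.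
  by rewrite -[X in (X - _)%N]cS addKn.
have Sn : (#|S| <= n)%N by have := max_card (mem S); rewrite card_ord.
by rewrite -expnD leq_exp2l// -[leqRHS](subnK Sn) leq_add2l.
Qed.

(** * Symmetrization on a finite space *)

Local Open Scope ring_scope.

Section FiniteVC.
Variables (R : realFieldType) (Y J : finType) (n : nat).
Variables (p : Y -> R) (c : J -> {set Y}).
Hypotheses (p_ge0 : forall y, 0 <= p y) (p_sum1 : \sum_y p y = 1).

Definition heavy k (y : {ffun 'I_n -> Y}) :=
  [exists j, (k <= #|[set i | y i \in c j]|)%N].

(** The double-sample event of the Vapnik-Chervonenkis argument. As the sets are light, the second
    half can be required to miss [c j] altogether. *)
Definition ghost k (z : {ffun 'I_n -> Y * Y}) :=
  [exists j, (k <= #|[set i | (z i).1 \in c j]|)%N &&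
             [forall i, (z i).2 \notin c j]].

Definition swap_pairs (s : {ffun 'I_n -> bool}) (z : {ffun 'I_n -> Y * Y}) :
    {ffun 'I_n -> Y * Y} :=
  [ffun i => if s i then ((z i).2, (z i).1) else z i].

Definition pair_weight (z : {ffun 'I_n -> Y * Y}) :=
  \prod_i (p (z i).1 * p (z i).2).

Lemma pair_weight_swap s z : pair_weight (swap_pairs s z) = pair_weight z.
Proof.
by apply: eq_bigr => i _; rewrite ffunE; case: (s i) => //=; rewrite mulrC.
Qed.

Lemma swap_pairsK s : involutive (swap_pairs s).
Proof.
move=> z; apply/ffunP => i; rewrite !ffunE.
by case: (s i) => //=; rewrite -surjective_pairing.
Qed.

Lemma pair_weight_ge0 z : 0 <= pair_weight z.
Proof. by apply: prodr_ge0 => i _; rewrite mulr_ge0. Qed.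

Lemma bernoulli_ineq (x : R) m : 0 <= x <= 1 -> 1 - m%:R * x <= (1 - x) ^+ m.
Proof.
move=> x01; elim: m => [|m IH]; first by rewrite mul0r subr0 expr0.
have h : (1 - x) * (1 - m%:R * x) <= (1 - x) ^+ m.+1.
  by rewrite exprS ler_wpM2l//; lra.
apply: le_trans h; rewrite -natr1.
have : 0 <= m%:R * x * x by rewrite !mulr_ge0//; lra.
by nra.
Qed.

(** Fix a heavy sample and a witness [j]. An independent second sample misses [c j] with probability
    at least [(1 - delta) ^+ n], hence at least [1 - n%:R * delta] and so [1 / 2]; this is where the
    factor 2 comes from. *)
Lemma ghost_sample delta k :
  (forall j, \sum_(y in c j) p y <= delta) -> n%:R * delta <= 2^-1 ->
  \sum_(y | heavy k y) \prod_i p (y i) <=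
    2 * \sum_(z | ghost k z) pair_weight z.
Proof.
move=> cd nd.
pose pairf (u : {ffun 'I_n -> Y} * {ffun 'I_n -> Y}) : {ffun 'I_n -> Y * Y} :=
  [ffun i => (u.1 i, u.2 i)].
pose unpair (z : {ffun 'I_n -> Y * Y}) :
    {ffun 'I_n -> Y} * {ffun 'I_n -> Y} :=
  ([ffun i => (z i).1], [ffun i => (z i).2]).
have pairK : cancel pairf unpair.
  by move=> [a b]; congr pair; apply/ffunP => i; rewrite !ffunE.
have unpairK : cancel unpair pairf.
  by move=> z; apply/ffunP => i; rewrite !ffunE -surjective_pairing.
rewrite [in leRHS](reindex pairf) /=; last first.
  by apply: onW_bij; exists unpair.
have -> : \sum_(u | ghost k (pairf u)) pair_weight (pairf u) =
    \sum_y \sum_(y' | ghost k (pairf (y, y')))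
      (\prod_i p (y i)) * (\prod_i p (y' i)).
  rewrite pair_big_dep/=; apply: eq_big => [[a b]//|[a b] _].
  by rewrite -big_split; apply: eq_bigr => i _; rewrite ffunE.
rewrite mulr_sumr big_mkcond; apply: ler_sum => y _.
have W y' : 0 <= \prod_i p (y' i) :> R by apply: prodr_ge0.
case: ifP => [/existsP[j kj]|_]; last first.
  by rewrite mulr_ge0// sumr_ge0// => y' _; rewrite mulr_ge0.
rewrite -mulr_sumr mulrCA -[leLHS]mulr1 ler_wpM2l// mulrC.
rewrite -ler_pdivrMr// div1r.
pose fam (i : 'I_n) : pred Y := [pred b | b \notin c j].
apply: (@le_trans _ _ (\sum_(y' in family fam) \prod_i p (y' i))); last first.
  rewrite big_mkcond [leRHS]big_mkcond; apply: ler_sum => y' _.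
  case: familyP => [h|_]; last by case: ifP => _ //.
  rewrite ifT//; apply/existsP; exists j; apply/andP; split.
    rewrite (_ : [set i | _] = [set i | y i \in c j])//.
    by apply/setP => i; rewrite !inE ffunE.
  by apply/forallP => i; rewrite ffunE /=; have := h i; rewrite unfold_in.
rewrite -(bigA_distr_big_dep fam (fun _ => p))/=.
rewrite (eq_bigr (fun=> \sum_(b | b \notin c j) p b))// prodr_const card_ord.
have -> : \sum_(y' | y' \notin c j) p y' = 1 - \sum_(y' in c j) p y'.
  by rewrite -p_sum1 [X in _ = X - _](bigID (mem (c j)))/= addrC addrK.
have q0 : 0 <= \sum_(y' in c j) p y' by apply: sumr_ge0.
have q1 : \sum_(y' in c j) p y' <= 1.
  by rewrite -p_sum1 [leRHS](bigID (mem (c j)))/= lerDl sumr_ge0.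
apply: le_trans (bernoulli_ineq n _); last by rewrite q0.
have : n%:R * (\sum_(y' in c j) p y') <= n%:R * delta by rewrite ler_wpM2l.
by lra.
Qed.

(** Restricted to points of positive weight because [Y] will be a type of membership patterns, and
    positive weight is what ensures that a pattern is realized by some point of the space. *)
Definition supp_vc_le (D : nat) := forall A : {set Y},
  (forall y, y \in A -> 0 < p y) -> fshatters [set c j | j : J] A ->
  (#|A| <= D)%N.

(** For fixed [z] the event depends on [c j] only through its trace on the [2 n] sample positions.
    Sauer-Shelah bounds the number of traces, and [card_swaps] the swaps for each trace. *)
Lemma card_ghost_swaps D k z : supp_vc_le D -> 0 < pair_weight z ->
  (#|[set s | ghost k (swap_pairs s z)]| * 2 ^ k <= n.*2.+1 ^ D * 2 ^ n)%N.
Proof.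
move=> vcD wz.
pose v (u : bool * 'I_n) := if u.1 then (z u.2).2 else (z u.2).1.
pose tr j := [set u | v u \in c j].
have pz i : 0 < p (z i).1 /\ 0 < p (z i).2.
  have : p (z i).1 * p (z i).2 != 0.
    apply: contraTneq wz => e.
    by rewrite /pair_weight (bigD1 i)//= e mul0r ltxx.
  by rewrite mulf_eq0 negb_or => /andP[a b]; rewrite !lt0r a b !p_ge0.
have trD : (#|[set tr j | j : J]| <= n.*2.+1 ^ D)%N.
  have -> : n.*2 = #|{: bool * 'I_n}|.
    by rewrite card_prod card_bool card_ord mul2n.
  apply: sauer_shelah => A /fshattersP shA.
  (* The sample may repeat values, but positions with equal values are never separated, so [v] is
     injective on a shattered set of positions. *)
  have vinj : {in A &, injective v}.
    move=> a b aA bA vab; have [|S /imsetP[j _ ->]] := shA [set a].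
      by rewrite sub1set.
    move=> e; have : a \in [set a] by rewrite inE.
    rewrite -e !inE aA vab => vb.
    by apply/esym/eqP; rewrite -in_set1 -e !inE bA.
  rewrite -(card_in_imset vinj); apply: vcD.
    by move=> _ /imsetP[u _ ->]; rewrite /v; have [] := pz u.2; case: u.1.
  apply/fshattersP => B BA.
  have [|S /imsetP[j _ ->] e] := shA [set u in A | v u \in B].
    by apply/subsetP => u; rewrite inE => /andP[].
  exists (c j); first exact: imset_f.
  apply/setP => y; rewrite inE; apply/andP/idP.
    case=> /imsetP[u uA ->] vuj.
    by have /setP/(_ u) := e; rewrite !inE uA vuj => /esym.
  move=> yB; have /imsetP[u uA yu] := subsetP BA _ yB.
  split; first exact: subsetP BA _ yB.
  by have /setP/(_ u) := e; rewrite !inE uA -yu yB.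
pose Sw (t : {set bool * 'I_n}) := [set s : {ffun 'I_n -> bool} |
  (k <= #|[set i | (s i, i) \in t]|)%N && [forall i, (~~ s i, i) \notin t]].
apply: (@leq_trans ((\sum_(t in [set tr j | j : J]) #|Sw t|) * 2 ^ k)).
  rewrite leq_mul2r; apply/orP; right.
  have Ule : (#|\bigcup_(t in [set tr j | j : J]) Sw t| <=
      \sum_(t in [set tr j | j : J]) #|Sw t|)%N.
    elim/big_rec2: _ => [|t m A _ h]; first by rewrite cards0.
    by apply: leq_trans (leq_add (leqnn _) h); exact: leq_card_setU.
  apply: leq_trans Ule.
  apply: subset_leq_card; apply/subsetP => s; rewrite inE => /existsP[j].
  move=> /andP[k1 /forallP k2]; apply/bigcupP; exists (tr j).
    exact: imset_f.
  rewrite inE; apply/andP; split.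
    apply: leq_trans k1 _; apply: subset_leq_card; apply/subsetP => i.
    by rewrite !inE ffunE /v; case: (s i).
  by apply/forallP => i; have := k2 i; rewrite !inE ffunE /v; case: (s i).
rewrite big_distrl/=; apply: leq_trans (leq_mul trD (leqnn _)).
by rewrite -sum_nat_const; apply: leq_sum => t _; exact: card_swaps.
Qed.

(** Swaps preserve the weight of a double sample, so the probability of [ghost] is the mean, over
    double samples, of the fraction of swaps that lead to it. *)
Lemma finite_vc delta D k : supp_vc_le D ->
  (forall j, \sum_(y in c j) p y <= delta) -> n%:R * delta <= 2^-1 ->
  \sum_(y : {ffun 'I_n -> Y} | [exists j, (k <= #|[set i | y i \in c j]|)%N])
    \prod_i p (y i) <= 2 * (n.*2.+1%:R ^+ D / 2 ^+ k).
Proof.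
move=> vcD cd nd; apply: le_trans (ghost_sample k cd nd) _.
rewrite ler_pM2l//.
have sym s : \sum_(z | ghost k z) pair_weight z =
    \sum_(z | ghost k (swap_pairs s z)) pair_weight z.
  rewrite (reindex_inj (inv_inj (swap_pairsK s)))/=.
  by apply: eq_bigr => z _; rewrite pair_weight_swap.
have avg : 2 ^+ n * \sum_(z | ghost k z) pair_weight z =
    \sum_z pair_weight z * #|[set s | ghost k (swap_pairs s z)]|%:R.
  have -> : 2 ^+ n * \sum_(z | ghost k z) pair_weight z =
      \sum_(s : {ffun 'I_n -> bool})
        \sum_(z | ghost k (swap_pairs s z)) pair_weight z.
    rewrite -(eq_bigr _ (fun s _ => sym s)) sumr_const.
    rewrite card_ffun card_bool card_ord.
    by rewrite -[RHS]mulr_natl natrX.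
  rewrite (exchange_big_dep xpredT)//=; apply: eq_bigr => z _.
  rewrite sumr_const mulr_natr; congr (_ *+ _).
  by apply: eq_card => s; rewrite !inE.
have pair_weight_sum1 : \sum_z pair_weight z = 1.
  rewrite -(bigA_distr_bigA (fun (_ : 'I_n) (u : Y * Y) => p u.1 * p u.2)).
  rewrite big1// => i _.
  rewrite -(pair_bigA _ (fun a b => p a * p b))/= -p_sum1.
  by apply: eq_bigr => a _; rewrite -mulr_sumr p_sum1 mulr1.
have two : 0 < 2 ^+ n :> R by rewrite exprn_gt0.
have twk : 0 < 2 ^+ k :> R by rewrite exprn_gt0.
rewrite -(ler_pM2l two) avg -[leRHS]mulr1 -[X in _ <= _ * X]pair_weight_sum1.
rewrite mulr_sumr.
apply: ler_sum => z _; rewrite mulrC.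
(* Double samples of weight 0 contribute nothing, and the swap count is only available for positive
   weight. *)
have [w0|w0] := eqVneq (pair_weight z) 0; first by rewrite w0 !mulr0.
rewrite ler_wpM2r ?pair_weight_ge0// mulrA ler_pdivlMr//.
rewrite -!natrX -!natrM ler_nat.
rewrite [leqRHS]mulnC; apply: card_ghost_swaps => //.
by rewrite lt0r w0 pair_weight_ge0.
Qed.

End FiniteVC.

From mathcomp Require Import all_classical all_reals all_analysis.
From mathcomp Require Import measurable_realfun.

Import Order.TTheory GRing.Theory Num.Theory.
Import numFieldNormedType.Exports.

Local Open Scope classical_set_scope.

(** * Countable classes and i.i.d. samples *)

Lemma measure_preimage_fin d (O : measurableType d) (R : realType)
    (m : {measure set O -> \bar R}) (Y : finType) (g : O -> Y) (Q : pred Y) :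
  (forall y, measurable (g @^-1` [set y])) ->
  measurable (g @^-1` [set y | Q y]) /\
  m (g @^-1` [set y | Q y]) = (\sum_(y | Q y) m (g @^-1` [set y]))%E.
Proof.
move=> mg.
suff h s : uniq s -> measurable (g @^-1` [set` s]) /\
    m (g @^-1` [set` s]) = (\sum_(y <- s) m (g @^-1` [set y]))%E.
  have -> : [set y | Q y] = [set` enum Q].
    by apply/seteqP; split => y /=; rewrite mem_enum.
  have [mQ ->] := h _ (enum_uniq Q); split=> //.
  by rewrite big_enum_cond /=; apply: eq_bigl => y; rewrite andbT.
elim: s => [_|y s IH /=/andP[ys us]].
  by rewrite big_nil set_nil preimage_set0 measure0; split.
have [ms mE] := IH us.
have e : g @^-1` [set` y :: s] = g @^-1` [set y] `|` g @^-1` [set` s].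
  apply/seteqP; split=> x /=; rewrite in_cons.
    by move=> /orP[/eqP|]; [left|right].
  by move=> [->|->]; rewrite ?eqxx ?orbT.
split; first by rewrite e; exact: measurableU.
have dis : g @^-1` [set y] `&` g @^-1` [set` s] = set0.
  by apply/seteqP; split => // x [/= -> ys']; rewrite ys' in ys.
by rewrite e measureU// big_cons -mE.
Qed.

Section IidVC.
Context (R : realType) (T : pmetricType R) (dW : measure_display)
  (W : measurableType dW).
Variables (P : probability W R) (mu : probability (borel T) R).
Variables (n : nat) (X : 'I_n -> W -> T).
Hypothesis X_iid : iid_sample P mu X.
Variable C : nat -> set T.
Hypothesis mC : forall j, measurable (C j : set (borel T)).

Definition hits k j : set W := [set v | (k <= #|[pred i | X i v \in C j]|)%N].

Definition membership J := {ffun 'I_J -> bool}.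
(** Names the atom, containing [x], of the algebra generated by the first [J] sets. This replaces
    the space by a finite one. *)
Definition pattern J (x : T) : membership J := [ffun j : 'I_J => x \in C j].

Lemma measurable_pattern J y :
  measurable (@pattern J @^-1` [set y] : set (borel T)).
Proof.
have -> : @pattern J @^-1` [set y] =
    \bigcap_(j : 'I_J) (if y j then C j else ~` C j).
  apply/seteqP; split=> [x <- j _|x h].
    rewrite ffunE; case: ifPn => [/set_mem//|h] Cx.
    by move: h; rewrite mem_set.
  apply/ffunP => j; rewrite ffunE; have := h j I.
  by case: (y j) => [/mem_set//|]; apply: contra_notF => /set_mem.
apply: fin_bigcap_measurable => [|j _]; first exact: finite_finset.
by case: ifP => _; [exact: mC|exact: measurableC (mC j)].
Qed.

Definition sample_pattern J (v : W) : {ffun 'I_n -> membership J} :=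
  [ffun i => pattern J (X i v)].

Lemma sample_patternE J y : sample_pattern J @^-1` [set y] =
  \bigcap_i (X i @^-1` (pattern J @^-1` [set y i])).
Proof.
apply/seteqP; split=> [v /= <- i _ /=|v h]; first by rewrite ffunE.
by apply/ffunP => i; rewrite ffunE; exact: h.
Qed.

Lemma measurable_sample_pattern J y :
  measurable (sample_pattern J @^-1` [set y]).
Proof.
have [mX _ _] := X_iid.
rewrite sample_patternE.
apply: fin_bigcap_measurable => [|i _]; first exact: finite_finset.
rewrite -[X in measurable X]setTI; apply: mX => //; exact: measurable_pattern.
Qed.

Lemma hitsE k J (j : 'I_J) : hits k j =
  sample_pattern J @^-1` [set y : {ffun 'I_n -> membership J} |
    (k <= #|[pred i | y i j]|)%N].
Proof.
have e v : #|[pred i | sample_pattern J v i j]| = #|[pred i | X i v \in C j]|.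
  by apply: eq_card => i; rewrite !inE !ffunE.
by apply/seteqP; split=> v /=; rewrite /hits /= e.
Qed.

Lemma measurable_hits k j : measurable (hits k j).
Proof.
(* The first [j.+1] sets suffice, [C j] being the last of them. *)
rewrite (hitsE k (@ord_max j)).
by have [] := measure_preimage_fin P
  (fun y : {ffun 'I_n -> membership j.+1} => (k <= #|[pred i | y i ord_max]|)%N)
  (@measurable_sample_pattern j.+1).
Qed.

(** The sample matters only through its patterns, which are i.i.d. on a finite type, so [finite_vc]
    applies. The bound does not depend on [J]. *)
Lemma iid_vc_fin delta D k J :
  (forall A m, (A #= `I_m)%card -> shatters (range C) A -> (m <= D)%N) ->
  (forall j, (mu (C j) <= delta%:E)%E) -> n%:R * delta <= 2^-1 ->
  (P (\bigcup_(j < J) hits k j) <= (2 * (n.*2.+1%:R ^+ D / 2 ^+ k))%:E)%E.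
Proof.
move=> vcD Cd nd; have [mX XE Xprod] := X_iid.
pose Q (y : {ffun 'I_n -> membership J}) :=
  [exists j : 'I_J, (k <= #|[pred i | y i j]|)%N].
have -> : \bigcup_(j < J) hits k j = sample_pattern J @^-1` [set y | Q y].
  apply/seteqP; split=> [v [j jJ]|v /existsP[j hj]].
    by rewrite (hitsE k (Ordinal jJ)) => h; apply/existsP; exists (Ordinal jJ).
  by exists j => //=; rewrite (hitsE k j).
have [_ ->] := measure_preimage_fin P Q (@measurable_sample_pattern J).
pose p (y : membership J) := fine (mu (pattern J @^-1` [set y])).
have pE y : mu (pattern J @^-1` [set y]) = (p y)%:E.
  by rewrite fineK// fin_num_measure//; exact: measurable_pattern.
have sample_patternP y :
    P (sample_pattern J @^-1` [set y]) = (\prod_i p (y i))%:E.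
  rewrite sample_patternE (Xprod (fun i => pattern J @^-1` [set y i])).
    rewrite -prodEFin; apply: eq_bigr => i _.
    by rewrite XE ?pE//; exact: measurable_pattern.
  by move=> i; exact: measurable_pattern.
rewrite (eq_bigr _ (fun y _ => sample_patternP y)) sumEFin lee_fin.
pose c (j : 'I_J) : {set membership J} := [set y : membership J | y j]%SET.
have QE y : Q y = [exists j, (k <= #|[set i | y i \in c j]%SET|)%N].
  apply: eq_existsb => j; congr (_ <= _)%N.
  by apply: eq_card => i; rewrite !inE.
rewrite (eq_bigl _ _ QE).
have mp := @measurable_pattern J.
apply: (@finite_vc _ _ _ _ p c _ _ delta) => //.
- by move=> y; rewrite fine_ge0.
- apply: EFin_inj; rewrite -sumEFin -(eq_bigr _ (fun y _ => pE y)).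
  have [_ <-] := measure_preimage_fin mu xpredT mp.
  by rewrite -(probability_setT mu); congr (mu _); apply/seteqP.
- move=> A pA /fshattersP shA.
  (* A pattern of positive weight has a nonempty fibre. [r] picks a point of it and carries
     shattered sets of patterns to sets shattered by the [C j]. *)
  have /choice[r rE] : forall y, exists x, y \in A -> pattern J x = y.
    move=> y; have [yA|yA] := boolP (y \in A); last by exists point.
    have /set0P[x xy] : pattern J @^-1` [set y] != set0.
      apply: contraTneq (pA y yA) => e.
      by rewrite /p e measure0 /= ltxx.
    by exists x.
  have rinj : {in A &, injective r}.
    by move=> y z yA zA e; rewrite -(rE y yA) -(rE z zA) e.
  apply: (vcD (r @` [set` A])).
    have -> : r @` [set` A] = (r \o enum_val) @` [set: 'I_#|A|].
      apply/seteqP; split => [x [y /= yA <-]|x [i _ <-]].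
        by exists (enum_rank_in yA y); rewrite //= enum_rankK_in.
      by exists (enum_val i) => //=; exact: enum_valP.
    apply: card_eq_trans (card_esym card_II).
    apply: inj_card_eq => i i' _ _ /= /rinj e.
    by apply: enum_val_inj; apply: e; exact: enum_valP.
  move=> B BA.
  have [|S /imsetP[j _ ->] e] := shA [set y in A | r y \in B]%SET.
    by apply/fintype.subsetP => y; rewrite inE => /andP[].
  exists (C j); first by exists j.
  apply/seteqP; split => [x [[y /= yA <-] Cx]|x Bx].
    have /setP/(_ y) := e; rewrite !inE yA /=.
    rewrite -{1}(rE y yA) ffunE mem_set//= => h.
    by apply/set_mem; rewrite -h.
  have [y yA ryx] := BA _ Bx; split; first by exists y.
  have /setP/(_ y) := e; rewrite !inE yA /= ryx.
  rewrite -(rE y yA) ffunE ryx => h; apply/set_mem; rewrite h; exact: mem_set.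
- move=> j; rewrite -lee_fin -sumEFin -(eq_bigr _ (fun y _ => pE y)).
  have [_ <-] := measure_preimage_fin mu (fun y => y \in c j) mp.
  apply: le_trans (Cd j); rewrite le_measure// ?inE//.
    by have [] := measure_preimage_fin mu (fun y => y \in c j) mp.
  by move=> x /=; rewrite inE ffunE => /set_mem.
Qed.

(** Continuity from below along the finite subfamilies. *)
Lemma iid_vc delta D k :
  (forall A m, (A #= `I_m)%card -> shatters (range C) A -> (m <= D)%N) ->
  (forall j, (mu (C j) <= delta%:E)%E) -> n%:R * delta <= 2^-1 ->
  (P (\bigcup_j hits k j) <= (2 * (n.*2.+1%:R ^+ D / 2 ^+ k))%:E)%E.
Proof.
move=> vcD Cd nd.
have -> : \bigcup_j hits k j = \bigcup_J \bigcup_(j < J) hits k j.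
  apply/seteqP; split=> [v [j _ h]|v [J _ [j _ h]]]; last by exists j.
  by exists j.+1 => //; exists j => /=.
have mU J : measurable (\bigcup_(j < J) hits k j).
  by apply: bigcup_measurable => j _; exact: measurable_hits.
have ndU : {homo (fun J => \bigcup_(j < J) hits k j) :
    a b / (a <= b)%N >-> (a <= b)%O}.
  move=> a b ab; apply/subsetPset.
  by move=> v [j /= ja h]; exists j => //=; exact: leq_trans ab.
have cvU := @nondecreasing_cvg_mu _ _ _ P _ mU
  (bigcup_measurable (fun J _ => mU J)) ndU.
rewrite -(cvg_lim (@ereal_hausdorff _) cvU); apply: lime_le.
  by apply/cvg_ex; eexists; exact: cvU.
by apply: nearW => J; exact: (@iid_vc_fin delta D k J vcD Cd nd).
Qed.

End IidVC.

(** * Concentration *)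

(* The integral of a nonnegative function is a supremum over the simple
   functions below it, hence monotone also on nonmeasurable functions. *)
Lemma le_integral_nonneg d (O : measurableType d) (R : realType)
    (m : {measure set O -> \bar R}) (f1 f2 : O -> \bar R) :
  (forall x, 0 <= f1 x)%E -> (forall x, f1 x <= f2 x)%E ->
  (\int[m]_x f1 x <= \int[m]_x f2 x)%E.
Proof.
move=> f10 f12.
have f20 x : (0 <= f2 x)%E by exact: le_trans (f12 x).
rewrite !ge0_integralTE//; apply: le_ereal_sup => _ [h hf <-].
by exists h => // x; apply: le_trans (f12 x).
Qed.

(** Markov's inequality by comparison with [c * \1_A]. Since [f] is not assumed measurable, it
    applies directly to query costs. *)
Lemma integral_ge_on d (O : measurableType d) (R : realType)
    (m : {measure set O -> \bar R}) (f : O -> \bar R) (A : set O) (c : R) :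
  measurable A -> 0 <= c -> (forall x, 0 <= f x)%E ->
  (forall x, A x -> c%:E <= f x)%E -> (c%:E * m A <= \int[m]_x f x)%E.
Proof.
move=> mA c0 f0 cf.
have <- : (\int[m]_x (c * \1_A x)%:E = c%:E * m A)%E.
  under eq_integral do rewrite EFinM.
  have mI : measurable_fun [set: O] (fun x => (\1_A x)%:E : \bar R).
    by apply/measurable_EFinP; exact: measurable_indic.
  rewrite (ge0_integralZl m measurableT mI) ?lee_fin//.
  by rewrite integral_indic// setIT.
apply: le_integral_nonneg => x; first by rewrite lee_fin mulr_ge0// indicE.
rewrite indicE; case: (boolP (x \in A)) => [/set_mem/cf|_].
  by rewrite mulr1.
by rewrite mulr0.
Qed.

Section MetricProb.
Context (R : realType) (T : pmetricType R).
Implicit Types (f : T -> R) (x y : T).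

Lemma lipschitz1_mdist x : lipschitz1 (mdist x).
Proof.
move=> y z; have := metric_triangle x y z; have := metric_triangle x z y.
rewrite (metric_sym z y) ler_norml => h1 h2.
by apply/andP; split; lra.
Qed.

Lemma lipschitz1N f : lipschitz1 f -> lipschitz1 (fun x => - f x).
Proof. by move=> lf x y; rewrite opprK addrC distrC; exact: lf. Qed.

Lemma open_lipschitz1_lt f a : lipschitz1 f -> open [set x | f x < a].
Proof.
move=> lf; rewrite openE => x /= fxa.
apply/metricType_numDomainType.nbhs_mdistP.
exists (a - f x) => /=; first by rewrite subr_gt0.
by move=> y /= xy; have := lf x y; rewrite ler_norml => /andP[h _]; lra.
Qed.

Lemma measurable_lipschitz1_lt f a : lipschitz1 f ->
  measurable ([set x | f x < a] : set (borel T)).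
Proof. by move=> lf; apply: sub_sigma_algebra; exact: open_lipschitz1_lt. Qed.

Lemma measurable_lipschitz1_gt f a : lipschitz1 f ->
  measurable ([set x | a < f x] : set (borel T)).
Proof.
move=> /lipschitz1N/(measurable_lipschitz1_lt (- a)).
rewrite (_ : [set x | - f x < - a] = [set x | a < f x])//.
by apply/seteqP; split=> x /=; rewrite ltrN2.
Qed.

Lemma measurable_lipschitz1_le f a : lipschitz1 f ->
  measurable ([set x | f x <= a] : set (borel T)).
Proof.
move=> /(measurable_lipschitz1_gt a) h.
rewrite (_ : [set x | f x <= a] = ~` [set x | a < f x]).
  exact: measurableC h.
by apply/seteqP; split=> x /=; rewrite real_leNgt ?num_real// => /negP.
Qed.

Lemma measurable_lipschitz1_ge f a : lipschitz1 f ->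
  measurable ([set x | a <= f x] : set (borel T)).
Proof.
move=> /(measurable_lipschitz1_lt a) h.
rewrite (_ : [set x | a <= f x] = ~` [set x | f x < a]).
  exact: measurableC h.
by apply/seteqP; split=> x /=; rewrite real_leNgt ?num_real// => /negP.
Qed.

Lemma measurable_lipschitz1 f : lipschitz1 f ->
  measurable_fun [set: borel T] (f : borel T -> R).
Proof.
move=> lf; apply: (measurability _ (RGenOInfty.measurableE R)).
move=> _ [_ [a ->] <-]; rewrite setTI preimage_itvoy.
exact: measurable_lipschitz1_gt.
Qed.

Lemma dist_to_lt (A : set T) x e : A !=set0 -> dist_to A x < e ->
  exists2 a, A a & mdist x a < e.
Proof.
move=> [a0 Aa0] /inf_lt[|_ [a Aa <-] ae]; last by exists a.
by exists (mdist x a0); exists a0.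
Qed.

Lemma dist_to_le (A : set T) x a : A a -> dist_to A x <= mdist x a.
Proof.
move=> Aa; apply: ge_inf; last by exists a.
by exists 0 => _ [y _ <-]; exact: mdist_ge0.
Qed.

Lemma lipschitz1_dist_to (A : set T) : A !=set0 -> lipschitz1 (dist_to A).
Proof.
move=> A0.
suff h x y : dist_to A x <= dist_to A y + mdist x y.
  move=> x y; have := h x y; have := h y x; rewrite (metric_sym y x) ler_norml.
  by move=> h1 h2; apply/andP; split; lra.
apply/ler_addgt0Pr => e e0.
have [||a Aa] := @dist_to_lt A y (dist_to A y + e) => //.
  by rewrite ltrDl.
have := dist_to_le x Aa; have := metric_triangle x y a; lra.
Qed.

Variable mu : probability (borel T) R.

Lemma measurable_nbhd (A : set T) e : A !=set0 ->
  measurable (nbhd A e : set (borel T)).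
Proof.
by move=> A0; apply: measurable_lipschitz1_lt; exact: lipschitz1_dist_to.
Qed.

Lemma prob_setC_le (A : set (borel T)) b : measurable A ->
  ((1 - b)%:E <= mu A)%E -> (mu (~` A) <= b%:E)%E.
Proof.
move=> mA; rewrite probability_setC//.
rewrite -(@fineK _ (mu A)) ?fin_num_measure// lee_fin -EFinB lee_fin; lra.
Qed.

Lemma prob_setC_ge_half (A : set (borel T)) : measurable A ->
  ~ ((2^-1)%:E <= mu A)%E -> ((2^-1)%:E <= mu (~` A))%E.
Proof.
move=> mA; rewrite probability_setC//.
rewrite -(@fineK _ (mu A)) ?fin_num_measure// lee_fin -EFinB lee_fin.
by move=> /negP; rewrite -ltNge; lra.
Qed.

Lemma conc_nbhd (A : set (borel T)) e b : 0 < e -> (conc_fun mu e <= b%:E)%E ->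
  measurable A -> ((2^-1)%:E <= mu A)%E ->
  A !=set0 /\ ((1 - b)%:E <= mu (nbhd A e))%E.
Proof.
move=> e0; rewrite /conc_fun gt_eqF// => cb mA A2; split.
  apply/set0P; apply: contraTneq A2 => ->; rewrite measure0 -ltNge lte_fin; lra.
set S := ereal_inf _ in cb.
apply: (@le_trans _ _ S); last by apply: ereal_inf_lbound; exists A.
(* As an infimum of probabilities [S] is nonnegative, which leaves a real value or [+oo]. *)
have S1 : (0 <= S)%E by apply: le_ereal_inf_tmp => _ [B _ <-].
move: S1 cb; case: S => [r||]//= _; last by rewrite leey.
by rewrite -EFinB !lee_fin; lra.
Qed.

(** By the Lipschitz condition, points with [a + e <= f x] lie outside the [e]-neighbourhood of the
    set where [f <= a]. *)
Lemma conc_above f a e b : lipschitz1 f -> 0 < e -> (conc_fun mu e <= b%:E)%E ->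
  ((2^-1)%:E <= mu [set x | (f x <= a)%R])%E ->
  (mu [set x | (a + e <= f x)%R] <= b%:E)%E.
Proof.
move=> lf e0 cb fa.
have mfa := measurable_lipschitz1_le a lf.
have [A0 nb] := conc_nbhd e0 cb mfa fa.
have mn := measurable_nbhd e A0.
apply: le_trans (prob_setC_le mn nb).
apply: le_measure; rewrite ?inE; first exact: measurable_lipschitz1_ge.
  exact: measurableC.
move=> x /= aex xn; have [y /= ya xy] := dist_to_lt A0 xn.
by have := lf x y; rewrite ler_norml => /andP[_ h]; lra.
Qed.

Lemma conc_below f a e b : lipschitz1 f -> 0 < e -> (conc_fun mu e <= b%:E)%E ->
  ((2^-1)%:E <= mu [set x | (a <= f x)%R])%E ->
  (mu [set x | (f x <= a - e)%R] <= b%:E)%E.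
Proof.
move=> lf e0 cb fa.
have := @conc_above (fun x => - f x) (- a) e b (lipschitz1N lf) e0 cb.
rewrite (_ : [set x | - f x <= - a] = [set x | a <= f x]); last first.
  by apply/seteqP; split=> x /=; rewrite lerN2.
rewrite (_ : [set x | - a + e <= - f x] = [set x | f x <= a - e]); first exact.
by apply/seteqP; split=> x /= h; lra.
Qed.

(** Either half of the mass has [f] at least [2 * s], or half has [f] at most [- (2 * s)], or
    neither holds. Concentration then moves the threshold by [s]: inwards in the first two cases,
    outwards on both sides in the last. *)
Lemma lipschitz1_trichotomy f s b : lipschitz1 f -> 0 < s ->
  (conc_fun mu s <= b%:E)%E ->
  [\/ (mu [set x | (f x <= s)%R] <= b%:E)%E,
      (mu [set x | (- s <= f x)%R] <= b%:E)%E |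
      (mu [set x | (3 * s <= f x)%R] <= b%:E)%E /\
      (mu [set x | (f x <= - (3 * s))%R] <= b%:E)%E].
Proof.
move=> lf s0 cb.
have [h|h] := pselect ((2^-1)%:E <= mu [set x | (2 * s <= f x)%R])%E.
  apply: Or31; have := conc_below lf s0 cb h.
  by rewrite (_ : 2 * s - s = s)//; lra.
have [h'|h'] := pselect ((2^-1)%:E <= mu [set x | (f x <= - (2 * s))%R])%E.
  apply: Or32; have := conc_above lf s0 cb h'.
  by rewrite (_ : - (2 * s) + s = - s)//; lra.
have mlt := measurable_lipschitz1_lt (2 * s) lf.
have mgt := measurable_lipschitz1_gt (- (2 * s)) lf.
have mle := measurable_lipschitz1_le (- (2 * s)) lf.
have mle' := measurable_lipschitz1_le (2 * s) lf.
have mge := measurable_lipschitz1_ge (2 * s) lf.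
have mge' := measurable_lipschitz1_ge (- (2 * s)) lf.
apply: Or33; split.
- rewrite (_ : 3 * s = 2 * s + s); last by lra.
  apply: conc_above => //; apply: le_trans (prob_setC_ge_half mge h) _.
  apply: le_measure; rewrite ?inE//; first exact: measurableC.
  by move=> x /= /negP; rewrite -ltNge => /ltW.
- rewrite (_ : - (3 * s) = - (2 * s) - s); last by lra.
  apply: conc_below => //; apply: le_trans (prob_setC_ge_half mle h') _.
  apply: le_measure; rewrite ?inE//; first exact: measurableC.
  by move=> x /= /negP; rewrite -ltNge => /ltW.
Qed.

End MetricProb.

(** * Mean distance and the measure of small balls *)

Section SmallBalls.
Context (R : realType) (T : pmetricType R).
Variable mu : probability (borel T) R.

Let int_cst (c : R) : (\int[mu]_x c%:E = c%:E)%E.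
Proof.
rewrite integral_cst// -[RHS]mule1; congr (_ * _)%E; exact: probability_setT.
Qed.

(** Layer by layer: [f] is at most [a + s] plus [s] times the number of [j] with
    [a + j.+1%:R * s <= f]. By concentration the measures of these layers sum to at most [1 / 3]. *)
Lemma integral_lipschitz1_le f a s : lipschitz1 f -> (forall x, 0 <= f x) ->
  0 <= a -> 0 < s ->
  (forall j, (conc_fun mu (j.+1%:R * s) <= ((4^-1) ^+ j.+1)%:E)%E) ->
  ((2^-1)%:E <= mu [set x | (f x <= a)%R])%E ->
  (\int[mu]_x (f x)%:E <= (a + s * (4 / 3))%:E)%E.
Proof.
move=> lf f0 a0 s0 cs fa.
pose A j := [set x | a + j.+1%:R * s <= f x] : set (borel T).
have mA j : measurable (A j) by exact: measurable_lipschitz1_ge.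
have Aj j : (mu (A j) <= ((4^-1) ^+ j.+1)%:E)%E.
  by apply: conc_above => //; rewrite mulr_gt0.
pose g j (x : borel T) := (s%:E * (\1_(A j) x)%:E)%E.
have g0 j x : (0 <= g j x)%E.
  by rewrite /g -EFinM lee_fin mulr_ge0 ?indicE// ltW.
have mI j : measurable_fun [set: borel T] (fun x => (\1_(A j) x)%:E : \bar R).
  by apply/measurable_EFinP; exact: measurable_indic.
have mg j : measurable_fun [set: borel T] (g j).
  by apply: measurable_funeM.
have fg x : ((f x)%:E <= (a + s)%:E + \sum_(j <oo) g j x)%E.
  (* The number of layers that [x] reaches. It is 0 when [f x < a], as [truncn] vanishes on negative
     numbers. *)
  pose N := Num.truncn ((f x - a) / s).
  apply: (@le_trans _ _ ((a + s)%:E + \sum_(0 <= j < N) g j x)%E); last first.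
    by apply: leeD => //; apply: nneseries_lim_ge => j _ _; exact: g0.
  have gs j : (j < N)%N -> g j x = s%:E.
    move=> jN; rewrite /g indicE mem_set ?mule1// /A /=.
    have : (j.+1 <= N)%N by [].
    have [fa0|fa0] := leP 0 ((f x - a) / s); last first.
      by move: jN; rewrite /N truncn_floor leNgt fa0.
    by rewrite truncn_ge_nat// ler_pdivlMr//; lra.
  rewrite big_nat (eq_bigr (fun=> s%:E)); last by move=> j /andP[_ /gs].
  rewrite -big_nat sumEFin -EFinD lee_fin sumr_const_nat subn0 -mulr_natl.
  have : (f x - a) / s < N.+1%:R by exact: truncnS_gt.
  by rewrite ltr_pdivrMr// -natr1; lra.
have mf : measurable_fun [set: borel T] (fun x : borel T => (f x)%:E).
  by apply/measurable_EFinP; exact: measurable_lipschitz1.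
apply: (@le_trans _ _ (\int[mu]_x ((a + s)%:E + \sum_(j <oo) g j x))%E).
  by apply: le_integral_nonneg => // x; rewrite lee_fin.
rewrite ge0_integralD//; last 3 first.
- by move=> x _; rewrite lee_fin addr_ge0// ltW.
- by move=> x _; apply: nneseries_ge0 => j _ _; exact: g0.
- by apply: ge0_emeasurable_sum => //; move=> j x _ _; exact: g0.
have -> : (\int[mu]_x (a + s)%:E = (a + s)%:E)%E.
  by rewrite int_cst.
rewrite integral_nneseries//.
rewrite (_ : a + s * (4 / 3) = (a + s) + s / 3); last by lra.
rewrite [leRHS]EFinD; apply: leeD => //.
have gI j : (\int[mu]_x g j x <= (s * (4^-1) ^+ j.+1)%:E)%E.
  rewrite (ge0_integralZl mu measurableT (mI j)) ?lee_fin ?(ltW s0)//.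
  rewrite integral_indic// setIT EFinM.
  by apply: lee_wpmul2l; [rewrite lee_fin ltW|exact: Aj].
apply: lime_le.
  by apply: is_cvg_nneseries => j _ _; apply: integral_ge0 => x _; exact: g0.
apply: nearW => N.
apply: (@le_trans _ _ (\sum_(0 <= j < N) (s * (4^-1) ^+ j.+1)%:E)%E).
  by apply: lee_sum => j _; exact: gI.
rewrite sumEFin lee_fin -mulr_sumr ler_wpM2l ?(ltW s0)//.
suff -> : \sum_(0 <= j < N) (4^-1 : R) ^+ j.+1 = 3^-1 * (1 - (4^-1) ^+ N).
  have : 0 <= (4^-1 : R) ^+ N by rewrite exprn_ge0.
  by move: (_ ^+ N) => q; lra.
elim: N => [|N IH]; first by rewrite big_geq// expr0 subrr mulr0.
rewrite big_nat_recr//= IH !exprS; move: (_ ^+ N) => q; lra.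
Qed.

(* If a ball of radius 2 s around x0 had measure 1/2, the mean distance to x0
   would be at most (10 / 3) s by integral_lipschitz1_le, hence the expected
   distance of two points at most (20 / 3) s < 1 by the triangle inequality. *)
Lemma small_ball x0 s : 0 < s -> expected_dist mu = 1%E -> 20 * s < 3 ->
  (forall j, (conc_fun mu (j.+1%:R * s) <= ((4^-1) ^+ j.+1)%:E)%E) ->
  forall b, (conc_fun mu s <= b%:E)%E ->
  (mu [set y | (mdist x0 y <= s)%R] <= b%:E)%E.
Proof.
move=> s0 Emu s_small cs b cb.
have lx := lipschitz1_mdist x0.
have [h|h] := pselect ((2^-1)%:E <= mu [set y | (2 * s <= mdist x0 y)%R])%E.
  have := conc_below lx s0 cb h.
  by rewrite (_ : 2 * s - s = s)//; lra.
exfalso.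
have mge := measurable_lipschitz1_ge (2 * s) lx.
have mle := measurable_lipschitz1_le (2 * s) lx.
have half : ((2^-1)%:E <= mu [set y | (mdist x0 y <= 2 * s)%R])%E.
  apply: le_trans (prob_setC_ge_half mge h) _.
  apply: le_measure; rewrite ?inE//; first exact: measurableC.
  by move=> x /= /negP; rewrite -ltNge => /ltW.
have d0 y : 0 <= mdist x0 y by exact: mdist_ge0.
have s20 : 0 <= 2 * s by lra.
have I0 := integral_lipschitz1_le lx d0 s20 s0 cs half.
have mf : measurable_fun [set: borel T] (fun y : borel T => (mdist x0 y)%:E).
  by apply/measurable_EFinP; exact: measurable_lipschitz1.
pose c := fine (\int[mu]_y (mdist x0 y)%:E)%E.
have c0 : (0 <= \int[mu]_y (mdist x0 y)%:E)%E.
  by apply: integral_ge0 => y _; rewrite lee_fin.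
have cE : (\int[mu]_y (mdist x0 y)%:E = c%:E)%E.
  by rewrite fineK// ge0_fin_numE//; apply: le_lt_trans I0 _; rewrite ltry.
rewrite cE lee_fin in I0.
have cge0 : 0 <= c by rewrite -lee_fin -cE.
have : (expected_dist mu <= (c + c)%:E)%E; last by rewrite Emu lee_fin; lra.
apply: (@le_trans _ _ (\int[mu]_x ((mdist x0 x)%:E + c%:E))%E).
  apply: le_integral_nonneg => x.
    by apply: integral_ge0 => y _; rewrite lee_fin mdist_ge0.
  apply: (@le_trans _ _ (\int[mu]_y ((mdist x0 x)%:E + (mdist x0 y)%:E))%E).
    apply: le_integral_nonneg => y; first by rewrite lee_fin mdist_ge0.
    by rewrite -EFinD lee_fin (metric_sym x0 x) metric_triangle.
  rewrite ge0_integralD//; last by move=> y _; rewrite lee_fin.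
    by rewrite int_cst cE.
  by move=> y _; rewrite lee_fin.
rewrite ge0_integralD//.
  by rewrite int_cst cE.
by move=> y _; rewrite lee_fin.
Qed.

End SmallBalls.

(** * Query cost of a tree *)

Section TreeCost.
Context (R : realType) (T : pmetricType R).
Variables (mu : probability (borel T) R) (F : set (T -> R)).
Variables (n k : nat) (X : 'I_n -> T) (r delta : R).
Hypothesis delta_ge0 : 0 <= delta.
(** Sample points are counted by the sign of [f] and not by bins, so that this concerns single
    functions and can be settled before any tree is given. *)
Hypothesis node : forall f, F f -> exists2 Bad : set (borel T),
  measurable Bad /\ (mu Bad <= delta%:E)%E &
  [\/ (#|[pred i | (f (X i) <= 0)%R]| <= k)%N /\
        (forall w e, ~ Bad w -> r <= e -> - e < f w),
      (#|[pred i | (0 <= f (X i))%R]| <= k)%N /\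
        (forall w e, ~ Bad w -> r <= e -> f w < e) |
      forall w e, ~ Bad w -> r <= e -> - e < f w /\ f w < e].

(* m bounds the number of decision functions whose exceptional sets make up Bad.
   Where both children are visited, the left one receives no more of this budget
   than the number of points that it holds. *)
Lemma query_cost_ge t m : mtree_wf F t -> exists2 Bad : set (borel T),
  measurable Bad /\ (mu Bad <= (m%:R * delta)%:E)%E &
  forall w e, ~ Bad w -> r <= e ->
    (minn m #|[pred i | X i \in bin t]| <= k.+1 * query_cost X t w e)%N.
Proof.
have triv t' : exists2 Bad : set (borel T),
    measurable Bad /\ (mu Bad <= (0%:R * delta)%:E)%E &
    forall w e, ~ Bad w -> r <= e ->
    (minn 0 #|[pred i | X i \in bin t']| <= k.+1 * query_cost X t' w e)%N.
  exists set0; first by rewrite measure0 mul0r.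
  by move=> w e _ _; rewrite min0n.
elim: t m => [B|B f l IHl rt IHr] m /=.
  move=> _; exists set0; last first.
    by move=> w e _ _; rewrite geq_min; apply/orP; right; nia.
  by split=> //; rewrite measure0 lee_fin mulr_ge0.
move=> [[Ff Blr fl fr] [wfl wfr]].
case: m => [|m]; first exact: (triv (Node B f l rt)).
have cB : (#|[pred i | X i \in B]| <=
    #|[pred i | X i \in bin l]| + #|[pred i | X i \in bin rt]|)%N.
  rewrite -cardUI; apply: leq_trans (leq_addr _ _).
  apply: subset_leq_card; apply/fintype.subsetP => i iB.
  have /set_mem/Blr lr : X i \in B by exact: iB.
  change ((X i \in bin l) || (X i \in bin rt)).
  by case: lr => h; rewrite (mem_set h) ?orbT.
have cl : (#|[pred i | X i \in bin l]| <= #|[pred i | (f (X i) <= 0)%R]|)%N.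
  apply: subset_leq_card; apply/fintype.subsetP => i i_in.
  have /set_mem/fl : X i \in bin l by exact: i_in.
  exact.
have cr : (#|[pred i | X i \in bin rt]| <= #|[pred i | (0 <= f (X i))%R]|)%N.
  apply: subset_leq_card; apply/fintype.subsetP => i i_in.
  have /set_mem/fr : X i \in bin rt by exact: i_in.
  exact.
move: cB cl cr; set xB := #|_|; set xl := #|_|; set xr := #|_|.
set yl := #|_|; set yr := #|_| => cB cl cr.
have [Bad [mBad muBad] Badf] := node Ff.
have glue (Bad' : set (borel T)) m' : measurable Bad' ->
    (mu Bad' <= (m'%:R * delta)%:E)%E ->
    measurable (Bad `|` Bad') /\
    (mu (Bad `|` Bad') <= (m'.+1%:R * delta)%:E)%E.
  move=> mB' muB'; split; first exact: measurableU.
  apply: le_trans (measureU2 mu mBad mB') _.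
  by rewrite -natr1 mulrDl mul1r addrC EFinD leeD.
case: Badf => [[fk Badf]|[fk Badf]|Badf].
(* The right child is visited. The at most [k] points of the left one and one unit of budget are
   paid for by the operation at this node, which is weighted by [k.+1]. *)
- have [Bad' [mBad' muBad'] h] := IHr m wfr.
  exists (Bad `|` Bad'); first exact: glue.
  move=> w e wB re; have := h w e (fun b => wB (or_intror b)) re.
  rewrite (Badf w e (fun b => wB (or_introl b)) re) -/xr.
  by case: ifP => _; move: fk cB cl; rewrite -/yl !mulnDr muln1; lia.
- have [Bad' [mBad' muBad'] h] := IHl m wfl.
  exists (Bad `|` Bad'); first exact: glue.
  move=> w e wB re; have := h w e (fun b => wB (or_intror b)) re.
  rewrite (Badf w e (fun b => wB (or_introl b)) re) -/xl.
  by case: ifP => _; move: fk cB cr; rewrite -/yr !mulnDr muln1; lia.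
have [Badl [mBadl muBadl] hl] := IHl (minn m xl) wfl.
have [Badr [mBadr muBadr] hr] := IHr (m - minn m xl)%N wfr.
exists (Bad `|` (Badl `|` Badr)).
  apply: glue; first exact: measurableU.
  apply: le_trans (measureU2 mu mBadl mBadr) _.
  apply: le_trans (leeD muBadl muBadr) _.
  by rewrite -EFinD -mulrDl -natrD subnKC// geq_minl.
move=> w e wB re.
have := hl w e (fun b => wB (or_intror (or_introl b))) re.
have := hr w e (fun b => wB (or_intror (or_intror b))) re.
have [-> ->] := Badf w e (fun b => wB (or_introl b)) re.
by rewrite -/xl -/xr !mulnDr muln1; lia.
Qed.
End TreeCost.

(** * Uniform counts over a Lipschitz family *)

Section SampleUniform.
Context (R : realType) (T : pmetricType R).

Lemma countable_enum (D : set T) : countable D ->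
  exists h : nat -> T, forall x, D x -> exists m, h m = x.
Proof.
move=> /countable_injP[f finj].
have /choice[h hP] : forall m, exists x, (exists2 d, D d & f d = m) ->
    D x /\ f x = m.
  move=> m; have [[d Dd dm]|h] := pselect (exists2 d, D d & f d = m).
    by exists d.
  by exists point.
exists h => x Dx; exists (f x).
have [|Dh fh] := hP (f x); first by exists x.
by apply: finj; rewrite ?inE.
Qed.

(* Functions of a Lipschitz family are determined up to eta at any finitely many
   points of the closure of D by rational approximations of their values at
   nearby points of D, and there are only countably many such data. *)
Lemma countable_dense_subfamily (F : set (T -> R)) (D : set T) eta :
  F !=set0 -> (forall f, F f -> lipschitz1 f) -> countable D -> 0 < eta ->
  exists2 g : nat -> T -> R, forall j, F (g j) &
    forall f n (x : 'I_n -> T), F f -> (forall i, closure D (x i)) ->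
      exists j, forall i, `|g j (x i) - f (x i)| < eta.
Proof.
move=> [f0 Ff0] Flip /countable_enum[h hD] eta0.
pose good (s : seq (nat * rat)) (f : T -> R) :=
  forall p, p \in s -> `|f (h p.1) - ratr p.2| < eta / 4.
(* For each finite list of approximate values, choose one member of [F] that fits it whenever some
   member does. *)
have /choice[G GP] : forall s, exists f', F f' /\
    ((exists2 f, F f & good s f) -> good s f').
  move=> s; have [[f Ff gf]|gf] := pselect (exists2 f, F f & good s f).
    by exists f.
  by exists f0.
exists (fun j => G (odflt [::] (unpickle j))) => [j|f n x Ff xD].
  by have [] := GP (odflt [::] (unpickle j)).
have eta4 : 0 < eta / 4 by lra.
have /choice[m mP] : forall i, exists m, mdist (x i) (h m) < eta / 4.
  move=> i; have [y [Dy]] := xD i _ (nbhsx_ballx (x i) _ eta4).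
  rewrite ballEmdist /= => xy; have [m hm] := hD y Dy.
  by exists m; rewrite hm.
have /choice[q qP] : forall i, exists q : rat,
    `|f (h (m i)) - ratr q| < eta / 4.
  move=> i; set y := f (h (m i)).
  have [|q] := @rat_in_itvoo R (y - eta / 4) (y + eta / 4).
    by lra.
  rewrite in_itv /= => /andP[q1 q2]; exists q.
  by rewrite ltr_norml; apply/andP; split; lra.
pose s := [seq (m i, q i) | i <- enum 'I_n].
exists (pickle s) => i; rewrite pickleK /=.
have [FG GG] := GP s.
have gs : good s f by move=> _ /mapP[i' _ ->] /=.
have /(_ (m i, q i)) := GG (ex_intro2 _ _ f Ff gs).
rewrite (map_f (fun i => (m i, q i))) ?mem_enum// => /(_ isT) /=.
(* From [x i] to [h (m i)], on to the rational [q i], and back: four errors, each below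
   [eta / 4]. *)
have := qP i; have := Flip _ FG (x i) (h (m i)).
have := Flip _ Ff (x i) (h (m i)); have := mP i.
rewrite !(ler_norml, ltr_norml) => h1 /andP[h2 h3] /andP[h4 h5] /andP[h6 h7].
by move=> /andP[h8 h9]; apply/andP; split; lra.
Qed.

Context (dW : measure_display) (W : measurableType dW).
Variables (P : probability W R) (mu : probability (borel T) R).
Variables (n : nat) (X : 'I_n -> W -> T).
Hypothesis X_iid : iid_sample P mu X.
Hypothesis mu_sep : separably_supported mu.

(* Measurability: the uncountably many sets V f are replaced by countably many
   slightly larger sets U g. *)
Lemma sample_uniform (F : set (T -> R)) (U : (T -> R) -> set T)
    (V : (T -> R) -> pred T) eta delta D k :
  (forall f, F f -> lipschitz1 f) -> 0 < eta ->
  (forall f, F f -> measurable (U f : set (borel T))) ->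
  (forall f, F f -> (mu (U f) <= delta%:E)%E) -> n%:R * delta <= 2^-1 ->
  (forall f g x, F f -> F g -> `|g x - f x| < eta -> V f x -> U g x) ->
  (forall A m, (A #= `I_m)%card -> shatters [set U f | f in F] A ->
     (m <= D)%N) ->
  exists2 N : set W,
    measurable N /\ (P N <= (2 * (n.*2.+1%:R ^+ D / 2 ^+ k))%:E)%E &
    forall v f, ~ N v -> F f -> (#|[pred i | V f (X i v)]| <= k)%N.
Proof.
move=> Flip eta0 mU muU nd UV vcD.
have [F0|F0] := pselect (F !=set0); last first.
  exists set0; last by move=> v f _ Ff; case: F0; exists f.
  split=> //; rewrite measure0 lee_fin mulr_ge0// divr_ge0// exprn_ge0//.
have [Q Qcount muQ] := mu_sep.
have [g gF gdense] := countable_dense_subfamily F0 Flip Qcount eta0.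
have [mX XE Xprod] := X_iid.
have mQ : measurable (closure Q : set (borel T)).
  rewrite -[closure Q]setCK; apply: measurableC; apply: sub_sigma_algebra.
  by apply: closed_openC; exact: closed_closure.
(* The almost sure event that the whole sample lies where the countable subfamily approximates
   [F]. *)
pose G := \bigcap_i (X i @^-1` closure Q).
have mXQ i : measurable (X i @^-1` closure Q).
  by rewrite -[X in measurable X]setTI; apply: mX.
have mG : measurable G.
  by apply: fin_bigcap_measurable => [|i _]; [exact: finite_finset|exact: mXQ].
have PG : P G = 1%E.
  rewrite (Xprod (fun=> closure Q))//.
  by apply: big1 => i _; rewrite XE.
pose H := \bigcup_j hits X (U \o g) k j.
have mUg j : measurable ((U \o g) j : set (borel T)) by exact: mU.
have mH : measurable H.
  by apply: bigcup_measurable => j _; exact: (measurable_hits X_iid).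
exists (~` G `|` H).
  split; first by apply: measurableU => //; exact: measurableC.
  apply: (@le_trans _ _ (P (~` G) + P H)%E).
    by apply: measureU2 => //; exact: measurableC.
  rewrite probability_setC// PG subee// add0e.
  apply: (iid_vc X_iid mUg) nd => [A m Am shA|j]; last exact: muU.
  apply: vcD Am _ => B BA; have [S [j _ <-] AS] := shA B BA.
  by exists ((U \o g) j) => //; exists (g j).
move=> v f vN Ff.
have Gv : G v by apply: contrapT => Gv; apply: vN; left.
have [j gj] := gdense f n (fun i => X i v) Ff (fun i => Gv i I).
rewrite leqNgt; apply/negP => kV; apply: vN; right; exists j => //.
rewrite /hits /=; apply: leq_trans (ltnW kV) _.
apply: subset_leq_card; apply/fintype.subsetP => i iV.
suff : X i v \in U (g j) by [].
by apply/mem_set/(UV f) => //; exact: iV.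
Qed.

(** Two uses of [sample_uniform], one for each sign. The slack [s / 2] puts the countably many test
    sets between the set whose points are counted, with threshold 0, and the set of small measure,
    with threshold [s] or [- s]. *)
Lemma sample_counts (F : set (T -> R)) s delta p k :
  (forall f, F f -> lipschitz1 f) -> 0 < s ->
  n%:R * delta <= 2^-1 -> (vc_dim R (upper_sets F) <= p%:E)%E ->
  exists2 N : set W, measurable N /\
    (P N <= (4 * (n.*2.+1%:R ^+ (Num.truncn p) / 2 ^+ k))%:E)%E &
    forall v f, ~ N v -> F f ->
      ((mu [set x | (f x <= s)%R] <= delta%:E)%E ->
         (#|[pred i | (f (X i v) <= 0)%R]| <= k)%N) /\
      ((mu [set x | (- s <= f x)%R] <= delta%:E)%E ->
         (#|[pred i | (0 <= f (X i v))%R]| <= k)%N).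
Proof.
move=> Flip s0 nd vcp.
have vcD A m : (A #= `I_m)%card -> shatters (upper_sets F) A ->
    (m <= Num.truncn p)%N.
  move=> Am shA; have mp : m%:R <= p.
    rewrite -lee_fin; apply: le_trans vcp; apply: ereal_sup_ubound.
    by exists m => //; exists A.
  by rewrite truncn_ge_nat//; apply: le_trans mp.
pose FR := [set f | F f /\ (mu [set x | (f x <= s)%R] <= delta%:E)%E].
pose FL := [set f | F f /\ (mu [set x | (- s <= f x)%R] <= delta%:E)%E].
have s2 : 0 < s / 2 by lra.
have [|||||NR [mNR PNR] NRP] := @sample_uniform FR
  (fun f => [set x | f x < s / 2]) (fun f => [pred x | f x <= 0])
  (s / 2) delta (Num.truncn p) k _ s2 _ _ nd.
- by move=> f [/Flip].
- by move=> f [/Flip lf _]; exact: measurable_lipschitz1_lt.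
- move=> f [/Flip lf]; apply: le_trans; apply: le_measure; rewrite ?inE.
  + exact: measurable_lipschitz1_lt.
  + exact: measurable_lipschitz1_le.
  + by move=> x /=; lra.
- move=> f g x _ _; rewrite ltr_norml /= => /andP[_ h] fx; lra.
(* Here the test sets are complements of upper sets: an upper set cuts out [B] when its complement
   cuts out the rest of [A]. *)
- move=> A m Am shA; apply: (vcD A m Am) => B BA.
  have [|_ [f [Ff _] <-] AS] := shA (A `\` B); first by move=> x [].
  exists [set x | s / 2 <= f x]; first by exists f, (s / 2).
  apply/seteqP; split=> x /=.
    move=> [Ax fx]; apply: contrapT => Bx.
    have : (A `\` B) x by [].
    by rewrite -AS => -[_ /=]; lra.
  move=> Bx; split; first exact: BA.
  rewrite leNgt; apply/negP => fx.
  have : (A `&` [set x | f x < s / 2]) x by split=> //; exact: BA.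
  by rewrite AS => -[].
have [|||||NL [mNL PNL] NLP] := @sample_uniform FL
  (fun f => [set x | - (s / 2) <= f x]) (fun f => [pred x | 0 <= f x])
  (s / 2) delta (Num.truncn p) k _ s2 _ _ nd.
- by move=> f [/Flip].
- by move=> f [/Flip lf _]; exact: measurable_lipschitz1_ge.
- move=> f [/Flip lf]; apply: le_trans; apply: le_measure; rewrite ?inE.
  + exact: measurable_lipschitz1_ge.
  + exact: measurable_lipschitz1_ge.
  + by move=> x /=; lra.
- move=> f g x _ _; rewrite ltr_norml /= => /andP[h _] fx; lra.
- move=> A m Am shA; apply: (vcD A m Am) => B BA.
  have [_ [f [Ff _] <-] AS] := shA B BA.
  by exists [set x | - (s / 2) <= f x] => //; exists f, (- (s / 2)).
exists (NR `|` NL).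
  split; first exact: measurableU.
  apply: le_trans (measureU2 P mNR mNL) _; apply: le_trans (leeD PNR PNL) _.
  by rewrite -EFinD lee_fin -mulrDl (_ : 2 + 2 = 4 :> R)//; lra.
move=> v f vN Ff; split=> fs.
  by apply: NRP => //; move=> h; apply: vN; left.
by apply: NLP => //; move=> h; apply: vN; right.
Qed.

End SampleUniform.

(** * Lower bound on the optimal cost *)

Lemma measure_bigU_le d (O : measurableType d) (R : realType)
    (m : {measure set O -> \bar R}) (I : Type) (s : seq I) (A : I -> set O) b :
  (forall i, measurable (A i)) -> (forall i, (m (A i) <= b%:E)%E) ->
  measurable (\big[setU/set0]_(i <- s) A i) /\
  (m (\big[setU/set0]_(i <- s) A i) <= ((size s)%:R * b)%:E)%E.
Proof.
move=> mA Ab; elim: s => [|i s [mU IH]].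
  by rewrite big_nil measure0 mul0r; split.
rewrite big_cons; split; first exact: measurableU.
apply: le_trans (measureU2 m (mA i) mU) _.
by rewrite /= -natr1 mulrDl mul1r addrC EFinD leeD.
Qed.

Section CostBound.
Context (R : realType) (T : pmetricType R).
Context (dW : measure_display) (W : measurableType dW).
Variables (P : probability W R) (mu : probability (borel T) R).
Variables (n : nat) (X : 'I_n -> W -> T) (F : set (T -> R)).
Hypotheses (X_iid : iid_sample P mu X) (mu_sep : separably_supported mu).
Hypotheses (F_lip : forall f, F f -> lipschitz1 f)
  (mu_dist : expected_dist mu = 1%E).
Variables (p b : R).
Hypotheses (F_vc : (vc_dim R (upper_sets F) <= p%:E)%E) (n_gt0 : (0 < n)%N).
Hypothesis conc24 : (conc_fun mu 24^-1 <= b%:E)%E.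
Hypothesis conc8 : (conc_fun mu 8^-1 <= b%:E)%E.
Hypothesis conc_tail :
  forall j, (conc_fun mu (j.+1%:R * 8^-1) <= ((4^-1) ^+ j.+1)%:E)%E.
(** The factor 3 adds the exceptional sets of [n] nodes, of measure [2 * b] each, and [n] balls of
    measure [b]. Together they leave at least half of the queries. *)
Hypotheses (b_ge0 : 0 <= b) (nb : n%:R * (3 * b) <= 2^-1).

(** A union bound over the balls of radius [8^-1] around the points, each of which [small_ball]
    bounds by [b]. *)
Lemma nn_radius_ge (x : 'I_n -> T) : exists2 Bad : set (borel T),
  measurable Bad /\ (mu Bad <= (n%:R * b)%:E)%E &
  forall w, ~ Bad w -> 8^-1 <= nn_radius x w.
Proof.
pose A i := [set y | mdist (x i) y <= 8^-1] : set (borel T).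
have mA i : measurable (A i).
  by apply: measurable_lipschitz1_le; exact: lipschitz1_mdist.
have Ab i : (mu (A i) <= b%:E)%E by apply: small_ball => //; lra.
have [mU Ub] := measure_bigU_le (enum 'I_n) mA Ab.
exists (\big[setU/set0]_(i <- enum 'I_n) A i).
  by split=> //; move: Ub; rewrite size_enum_ord.
move=> w wU; apply: lb_le_inf.
  by exists (mdist w (x (Ordinal n_gt0))); exists (Ordinal n_gt0).
move=> _ [i _ <-]; rewrite metric_sym leNgt; apply/negP => xiw; apply: wU.
rewrite -bigcup_seq; exists i; first by rewrite /= mem_enum.
exact: ltW.
Qed.

(** A single event [N] serves all trees at once, because the counts are uniform over [F]. *)
Lemma optimal_cost_ge k : exists2 N : set W, measurable N /\
    (P N <= (4 * (n.*2.+1%:R ^+ (Num.truncn p) / 2 ^+ k))%:E)%E &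
    forall v, ~ N v ->
      ((n%:R / (2 * k.+1%:R))%:E <= optimal_cost (fun i => X i v) mu F)%E.
Proof.
(* At this scale the outer threshold [3 * 24^-1] of the trichotomy is [8^-1], the lower bound on the
   search radius. *)
have s0 : 0 < 24^-1 :> R by lra.
have nb2 : n%:R * b <= 2^-1.
  have : 0 <= n%:R * b by rewrite mulr_ge0.
  by move: nb; rewrite mulrCA; lra.
have [N mPN NP] := sample_counts X_iid mu_sep k F_lip s0 nb2 F_vc.
exists N => // v vN.
apply: le_ereal_inf_tmp => _ [t [tT wft] <-].
have node f : F f -> exists2 Bad : set (borel T),
  measurable Bad /\ (mu Bad <= (2 * b)%:E)%E &
  [\/ (#|[pred i | (f (X i v) <= 0)%R]| <= k)%N /\
        (forall w e, ~ Bad w -> 8^-1 <= e -> - e < f w),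
      (#|[pred i | (0 <= f (X i v))%R]| <= k)%N /\
        (forall w e, ~ Bad w -> 8^-1 <= e -> f w < e) |
      forall w e, ~ Bad w -> 8^-1 <= e -> - e < f w /\ f w < e].
  move=> Ff; have lf := F_lip Ff; have [hR hL] := NP v f vN Ff.
  have b2 : (b%:E <= (2 * b)%:E)%E by rewrite lee_fin; move: b_ge0; lra.
  have [h|h|[h1 h2]] := lipschitz1_trichotomy lf s0 conc24.
  - exists [set x | f x <= 24^-1].
      split; first exact: measurable_lipschitz1_le.
      exact: le_trans b2.
    apply: Or31; split=> [|w e /= /negP]; first exact: hR.
    by rewrite -ltNge => h1 h2; lra.
  - exists [set x | - 24^-1 <= f x].
      split; first exact: measurable_lipschitz1_ge.
      exact: le_trans b2.
    apply: Or32; split=> [|w e /= /negP]; first exact: hL.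
    by rewrite -ltNge => h1 h2; lra.
  have m1 := measurable_lipschitz1_ge (3 * 24^-1) lf.
  have m2 := measurable_lipschitz1_le (- (3 * 24^-1)) lf.
  exists ([set x | 3 * 24^-1 <= f x] `|` [set x | f x <= - (3 * 24^-1)]).
    split; first exact: measurableU.
    apply: le_trans (measureU2 mu m1 m2) _; apply: le_trans (leeD h1 h2) _.
    by rewrite -EFinD lee_fin; lra.
  apply: Or33 => w e wB re.
  have w1 : f w < 3 * 24^-1 by rewrite ltNge; apply/negP => h; apply: wB; left.
  have w2 : - (3 * 24^-1) < f w.
    by rewrite ltNge; apply/negP => h; apply: wB; right.
  by split; lra.
have b20 : 0 <= 2 * b by move: b_ge0; lra.
have [B1 [mB1 muB1] B1P] := query_cost_ge b20 node n wft.
have [B2 [mB2 muB2] B2P] := nn_radius_ge (fun i => X i v).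
have mB := measurableU _ _ mB1 mB2.
have muB : (mu (B1 `|` B2) <= (2^-1)%:E)%E.
  apply: le_trans (measureU2 mu mB1 mB2) _; apply: le_trans (leeD muB1 muB2) _.
  by rewrite -EFinD lee_fin mulrCA; move: nb; rewrite mulrCA; lra.
have muBC : ((2^-1)%:E <= mu (~` (B1 `|` B2)))%E.
  rewrite probability_setC//; move: muB.
  rewrite -(@fineK _ (mu (B1 `|` B2))) ?fin_num_measure//.
  by rewrite -EFinB !lee_fin; lra.
have k0 : 0 < k.+1%:R :> R by [].
(* Outside the exceptional sets, on at least half of the mass, a query costs at least
   [n%:R / k.+1%:R]. *)
apply: (@le_trans _ _ ((n%:R / k.+1%:R)%:E * mu (~` (B1 `|` B2)))%E).
  apply: (@le_trans _ _ ((n%:R / k.+1%:R)%:E * (2^-1)%:E)%E).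
    by rewrite -EFinM lee_fin invfM mulrCA [leLHS]mulrC.
  by apply: lee_wpmul2l => //; rewrite lee_fin divr_ge0.
apply: integral_ge_on => [||w|w wB].
- exact: measurableC.
- by rewrite divr_ge0.
- by rewrite lee_fin.
rewrite lee_fin ler_pdivrMr// -natrM ler_nat mulnC.
have re : 8^-1 <= nn_radius (fun i => X i v) w.
  by apply: B2P => h; apply: wB; right.
apply: leq_trans (B1P w _ _ re); last by move=> h; apply: wB; left.
rewrite tT (eq_card (B := predT)) ?card_ord ?minnn// => i.
by rewrite [LHS]inE; exact: mem_set.
Qed.

End CostBound.

(** * Asymptotics *)

Section Asymptotics.
Variable R : realType.

(** [C] is the sum of the absolute values of the coefficients. The exponent [size p] also covers the
    zero polynomial. *)
Lemma horner_le_monomial (p : {poly R}) :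
  exists2 C : R, 0 <= C & forall x, 1 <= x -> p.[x] <= C * x ^+ size p.
Proof.
exists (\sum_(i < size p) `|p`_i|); first by apply: sumr_ge0.
move=> x x1; rewrite horner_coef mulr_suml; apply: ler_sum => i _.
apply: le_trans (ler_norm _) _; rewrite normrM ler_wpM2l//.
rewrite ger0_norm ?exprn_ge0 ?(le_trans ler01)//.
by rewrite ler_weXn2l// ltnW.
Qed.

Lemma near_natr_expR_small (c eps : R) : 0 < c -> 0 < eps ->
  \forall d \near \oo, expR (- (c * d%:R)) <= eps.
Proof.
move=> c0 eps0; near=> d.
have h : eps^-1 <= expR (c * d%:R).
  apply: le_trans (expR_ge1Dx _).
  have : eps^-1 / c <= d%:R :> R by near: d; exact: nbhs_infty_ger.
  by rewrite ler_pdivrMr// mulrC; lra.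
by rewrite expRN -[leRHS]invrK lef_pV2// ?posrE ?invr_gt0 ?expR_gt0.
Unshelve. all: by end_near. Qed.

Variables (n : nat -> nat) (e : nat -> R).
Hypotheses (e0 : e d @[d --> \oo] --> (0 : R))
  (de : \forall d \near \oo, d%:R = (n d)%:R `^ e d)
  (n_small : ln (n d)%:R / d%:R @[d --> \oo] --> (0 : R)).

(** If [n d] were 0, the power in [de] would be 0 or 1, while [d] is at least 2. *)
Lemma near_n_gt0 : \forall d \near \oo, (0 < n d)%N.
Proof.
near=> d; rewrite lt0n; apply/eqP => nd.
have : d%:R = (n d)%:R `^ e d :> R by near: d.
have d2 : 2 <= d%:R :> R by near: d; exact: nbhs_infty_ger.
have [->|ed] := eqVneq (e d) 0; first by rewrite powRr0; lra.
by rewrite nd powR0//; lra.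
Unshelve. all: by end_near. Qed.

(** The form in which [d] being a vanishing power of [n] is used: [n] outgrows every power of
    [d]. *)
Lemma near_ln_d_le (eps : R) : 0 < eps ->
  \forall d \near \oo, ln d%:R <= eps * ln (n d)%:R.
Proof.
move=> eps0; near=> d.
have -> : d%:R = (n d)%:R `^ e d :> R by near: d.
rewrite ln_powR ler_wpM2r//.
  by apply: ln_ge0; rewrite ler1n; near: d; exact: near_n_gt0.
apply: le_trans (ler_norm _) _.
by near: d; exact: (cvgr0_norm_le _ e0).
Unshelve. all: by end_near. Qed.

Lemma near_n_le_expR (c : R) : 0 < c ->
  \forall d \near \oo, (n d)%:R <= expR (c * d%:R).
Proof.
move=> c0; near=> d.
have d1 : 1 <= d%:R :> R by near: d; exact: nbhs_infty_ger.
have n0 : 0 < (n d)%:R :> R by rewrite ltr0n; near: d; exact: near_n_gt0.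
rewrite -[leLHS](@lnK R) ?posrE// ler_expR -ler_pdivrMr; last by lra.
apply: le_trans (ler_norm _) _.
by near: d; apply: (cvgr0_norm_le _ n_small).
Unshelve. all: by end_near. Qed.

(** Since [n <= 2 ^ (d / 2)] eventually, [2 n + 1 <= 4 n <= 2 ^ (2 + d / 2)], and this is at most
    [2 ^ d] once [d] is at least 4. *)
Lemma near_2n_le_2X : \forall d \near \oo, ((n d).*2.+1)%:R <= 2 ^+ d :> R.
Proof.
have l2 : 0 < ln 2 :> R by apply: ln_gt0; lra.
have l22 : 0 < ln 2 / 2 :> R by rewrite divr_gt0.
near=> d.
have n0 : 1 <= (n d)%:R :> R by rewrite ler1n; near: d; exact: near_n_gt0.
have d4 : 4 <= d%:R :> R by near: d; exact: nbhs_infty_ger.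
have nd : (n d)%:R <= expR (ln 2 / 2 * d%:R) :> R.
  by near: d; exact: near_n_le_expR l22.
have two (m : nat) : expR (ln 2 * m%:R) = 2 ^+ m :> R.
  by rewrite expRM_natr lnK// posrE.
apply: (@le_trans _ _ (2 ^+ 2 * expR (ln 2 / 2 * d%:R))).
  by rewrite -natr1 -mul2n natrM expr2; lra.
rewrite -!two -expRD ler_expR.
have -> : ln 2 * 2%:R + ln 2 / 2 * d%:R = ln 2 * (2 + d%:R / 2) :> R by lra.
by rewrite ler_pM2l//; lra.
Unshelve. all: by end_near. Qed.

(* With D the VC dimension, (2 n + 1) ^ D / 2 ^ ((D + 1) d) <= 2 ^- d as soon as
   2 n + 1 <= 2 ^ d. *)
Definition hit_bound (p : {poly R}) (d : nat) : nat :=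
  ((Num.truncn p.[d%:R]).+1 * d)%N.

(** With [s] the size of [p], the number under the logarithm is at most [(2 * C + 4) * d ^ (s + 1)],
    hence at most [d ^ (s + 2)] for large [d]. *)
Lemma near_ln_hit_bound p : exists r : nat,
  \forall d \near \oo, ln (2 * (hit_bound p d).+1%:R) <= r%:R * ln d%:R :> R.
Proof.
have [C C0 pC] := horner_le_monomial p.
exists (size p).+2; near=> d.
have d1 : 1 <= d%:R :> R by near: d; exact: nbhs_infty_ger.
have dC : 2 * C + 4 <= d%:R by near: d; exact: nbhs_infty_ger.
set x : R := d%:R in d1 dC *.
have x0 : 0 < x by lra.
have xs : 1 <= x ^+ size p by rewrite exprn_ege1.
have tr : (Num.truncn p.[x])%:R <= C * x ^+ size p.
  have [p0|p0] := leP 0 p.[x].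
    by apply: le_trans (pC x d1); rewrite truncn_le.
  by rewrite truncn_floor (lt_geF p0) mulr_ge0// (le_trans ler01).
have xpos m : 0 < x ^+ m by rewrite exprn_gt0.
have h0 : 0 < 2 * (hit_bound p d).+1%:R :> R by rewrite mulr_gt0.
rewrite [leRHS]mulr_natl -lnXn// ler_ln ?posrE ?xpos//.
rewrite /hit_bound -[X in 2 * X]natr1 natrM -[X in 2 * (X * _ + 1)]natr1 -/x.
rewrite !exprS.
set y := x ^+ size p in tr xs *; move: (_%:R) tr => t tr.
have h1 : t * x <= C * y * x by rewrite ler_wpM2r// ltW.
have h2 : x <= x * y by rewrite -[leLHS]mulr1 ler_wpM2l// ltW.
have xy0 : 0 <= x * y by lra.
have h3 : (2 * C + 4) * (x * y) <= x * (x * y) by rewrite ler_wpM2r.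
have h4 : C * y * x = C * (x * y) by lra.
by lra.
Unshelve. all: by end_near. Qed.

(** The logarithm to base [d] of the bound in [optimal_cost_ge] for [k] equal to [hit_bound p d]. *)
Definition cost_exponent (p : {poly R}) (d : nat) : R :=
  ln ((n d)%:R / (2 * (hit_bound p d).+1%:R)) / ln d%:R.

Lemma cost_exponent_cvgy p : cost_exponent p d @[d --> \oo] --> +oo.
Proof.
have [r rP] := near_ln_hit_bound p.
apply/cvgryPge => A.
(* The denominator uses up [r] powers of [d] and the target needs [A] more; the 1 makes [M]
   positive. *)
pose M := `|A| + r%:R + 1.
have M0 : 0 < M by rewrite ltr_wpDl// addr_ge0.
near=> d.
have d2 : 2 <= d%:R :> R by near: d; exact: nbhs_infty_ger.
have n0 : 0 < (n d)%:R :> R by rewrite ltr0n; near: d; exact: near_n_gt0.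
have ld : ln d%:R <= M^-1 * ln (n d)%:R.
  by near: d; apply: near_ln_d_le; rewrite invr_gt0.
have hk : ln (2 * (hit_bound p d).+1%:R) <= r%:R * ln d%:R :> R by near: d.
have l0 : 0 < ln d%:R :> R by apply: ln_gt0; lra.
rewrite /cost_exponent ler_pdivlMr// ln_div ?posrE ?mulr_gt0//.
have : M * ln d%:R <= ln (n d)%:R by rewrite mulrC -ler_pdivlMr// mulrC.
have : A * ln d%:R <= `|A| * ln d%:R by rewrite ler_wpM2r ?ler_norm// ltW.
by rewrite /M; move: hk l0; move: (ln d%:R) => l; nra.
Unshelve. all: by end_near. Qed.

Lemma powR_cost_exponent p d : (1 < d)%N -> (0 < n d)%N ->
  d%:R `^ cost_exponent p d = (n d)%:R / (2 * (hit_bound p d).+1%:R).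
Proof.
move=> d1 n0; have l0 : 0 < ln d%:R :> R by apply: ln_gt0; rewrite ltr1n.
rewrite /powR pnatr_eq0 gtn_eqF ?(ltnW d1)// /cost_exponent divfK ?gt_eqF//.
by rewrite lnK// posrE divr_gt0 ?mulr_gt0 ?ltr0n.
Qed.

End Asymptotics.

(** One bound [b] serves both scales, as concentration is stronger at [8^-1] than at [24^-1]. In the
    tail, the exponent at radius [j.+1%:R * 8^-1] is [j.+1 ^ 2], so at least [j.+1], times that at
    [8^-1], which makes the threshold on [d] uniform in [j]. *)
Lemma near_concentration (R : realType) (T : nat -> pmetricType R)
    (mu : forall d, probability (borel (T d)) R) (n : nat -> nat) :
  concentration_dim_Theta mu ->
  (forall c : R, 0 < c ->
    \forall d \near \oo, (n d)%:R <= expR (c * d%:R)) ->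
  exists b : nat -> R, \forall d \near \oo,
    [/\ 0 <= b d, (n d)%:R * (3 * b d) <= 2^-1,
      (conc_fun (mu d) 24^-1 <= (b d)%:E)%E,
      (conc_fun (mu d) 8^-1 <= (b d)%:E)%E &
      forall j, (conc_fun (mu d) (j.+1%:R * 8^-1) <= ((4^-1) ^+ j.+1)%:E)%E].
Proof.
move=> [c1 [c2 [e0 [K [c1_gt0 _ _ conc]]]]] n_le.
pose s2 : R := 24^-1 ^+ 2.
have s2_gt0 : 0 < s2 by rewrite exprn_gt0.
(* Half of the exponent of [b d]: one half absorbs [n d], the other is small enough to absorb the
   constant factor. *)
pose c := c1 * s2 / 2.
have c_gt0 : 0 < c by rewrite divr_gt0// mulr_gt0.
exists (fun d => expR (- (c1 * (s2 * d%:R)))); near=> d.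
have concd : forall e : R, 0 < e -> K <= e ^+ 2 * d%:R ->
    (conc_fun (mu d) e <= (expR (- (c1 * (e ^+ 2 * d%:R))))%:E)%E.
  move=> e e_gt0 Ke; have : forall e : R, 0 < e -> K <= e ^+ 2 * d%:R ->
    (conc_fun (mu d) e <= (expR (- (c1 * (e ^+ 2 * d%:R))))%:E)%E /\
    (e <= e0 -> ((expR (- (c2 * (e ^+ 2 * d%:R))))%:E <= conc_fun (mu d) e)%E).
    by near: d.
  by move=> /(_ e e_gt0 Ke)[].
(* Through [s2e] this meets the threshold [K] for all radii from [24^-1] on at once. *)
have Kd : K <= s2 * d%:R.
  rewrite mulrC -ler_pdivrMr//; near: d; exact: nbhs_infty_ger.
have d0 : 0 <= d%:R :> R by [].
have s2e : forall e : R, 24^-1 <= e -> s2 * d%:R <= e ^+ 2 * d%:R.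
  by move=> e es; rewrite ler_wpM2r// ler_sqr// nnegrE; lra.
have q4 : expR (- (c1 * 8^-1 ^+ 2 * d%:R)) <= 4^-1.
  near: d; apply: near_natr_expR_small => //.
  by rewrite mulr_gt0// exprn_gt0.
split.
- exact: expR_ge0.
- have nc : (n d)%:R <= expR (c * d%:R) by near: d; exact: n_le.
  have cs : expR (- (c * d%:R)) <= 6^-1 by near: d; exact: near_natr_expR_small.
  have -> : - (c1 * (s2 * d%:R)) = - (c * d%:R) - c * d%:R by rewrite /c; lra.
  rewrite expRD; move: nc cs; rewrite expRN.
  move: (expR_gt0 (c * d%:R)); move: (expR _) => x x0 nx x6.
  have : (n d)%:R * x^-1 <= 1 by rewrite ler_pdivrMr// mul1r.
  have : 0 < x^-1 by rewrite invr_gt0.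
  by move: (x^-1) x6 => y y6 y0 ny; nra.
- by apply: concd => //; rewrite invr_gt0.
- apply: le_trans (concd 8^-1 _ _) _; first by rewrite invr_gt0.
    by apply: le_trans (s2e _ _); rewrite // lef_pV2 ?posrE//; lra.
  rewrite lee_fin ler_expR lerN2 ler_pM2l//; apply: s2e.
  by rewrite lef_pV2 ?posrE//; lra.
move=> j.
have j1 : 1 <= j.+1%:R :> R by rewrite ler1n.
apply: le_trans (concd _ _ _) _.
- by rewrite mulr_gt0// invr_gt0.
- apply: le_trans (s2e _ _) => //; lra.
rewrite lee_fin.
apply: (@le_trans _ _ (expR (- (c1 * 8^-1 ^+ 2 * d%:R)) ^+ j.+1)); last first.
  by apply: lerXn2r; rewrite ?nnegrE ?expR_ge0.
rewrite -expRM_natl ler_expR mulrN lerN2 exprMn.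
have -> : c1 * (j.+1%:R ^+ 2 * 8^-1 ^+ 2 * d%:R) =
    j.+1%:R ^+ 2 * (c1 * 8^-1 ^+ 2 * d%:R) by lra.
rewrite ler_wpM2r//; last by rewrite expr2 -[leLHS]mulr1 ler_wpM2l.
by rewrite !mulr_ge0// ltW.
Unshelve. all: by end_near. Qed.

Theorem theorem3 (R : realType)
    (T : nat -> pmetricType R)
    (mu : forall d : nat, probability (borel (T d)) R)
    (F : forall d : nat, set (T d -> R))
    (n : nat -> nat)
    (dW : nat -> measure_display)
    (W : forall d : nat, measurableType (dW d))
    (P : forall d : nat, probability (W d) R)
    (X : forall d : nat, 'I_(n d) -> W d -> T d)
    (mu_sep : forall d : nat, separably_supported (mu d))
    (mu_conc : concentration_dim_Theta mu)
    (mu_dist : forall d : nat, expected_dist (mu d) = 1%E)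
    (F_lip : forall (d : nat) (f : T d -> R), F d f -> lipschitz1 f)
    (F_vc : exists p : {poly R}, \forall d \near \oo,
       (vc_dim R (upper_sets (F d)) <= (p.[d%:R])%:E)%E)
    (d_small : exists e : nat -> R, (e d @[d --> \oo] --> (0 : R)) /\
       \forall d \near \oo, d%:R = (n d)%:R `^ e d)
    (d_large : ln (n d)%:R / d%:R @[d --> \oo] --> (0 : R))
    (X_iid : forall d : nat, iid_sample (P d) (mu d) (X d)) :
  exists g : nat -> R, (g d @[d --> \oo] --> +oo) /\
    with_confidence_to_1 P (fun d : nat =>
      [set v : W d | ((d%:R `^ g d)%:E
         <= optimal_cost (fun i => X d i v) (mu d) (F d))%E]).
Proof.
have [p p_vc] := F_vc; have [e [e0 de]] := d_small.
have n_gt0 := near_n_gt0 de.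
have [b b_conc] := near_concentration mu_conc (near_n_le_expR de d_large).
exists (cost_exponent n p); split; first exact: cost_exponent_cvgy e0 de p.
pose G d := [set v : W d | ((d%:R `^ cost_exponent n p d)%:E
  <= optimal_cost (fun i => X d i v) (mu d) (F d))%E].
pose bound d : R :=
  (n d).*2.+1%:R ^+ (Num.truncn p.[d%:R]) / 2 ^+ hit_bound p d.
(* An event is needed for every [d]; where the eventual estimates fail, the empty one is taken. *)
have good d : exists E : set (W d), (measurable E /\ E `<=` G d) /\
    ([/\ (1 < d)%N, (0 < n d)%N,
      (vc_dim R (upper_sets (F d)) <= (p.[d%:R])%:E)%E &
      [/\ 0 <= b d, (n d)%:R * (3 * b d) <= 2^-1,
      (conc_fun (mu d) 24^-1 <= (b d)%:E)%E,
      (conc_fun (mu d) 8^-1 <= (b d)%:E)%E &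
      forall j, (conc_fun (mu d) (j.+1%:R * 8^-1) <= ((4^-1) ^+ j.+1)%:E)%E]] ->
    ((1 - 4 * bound d)%:E <= P d E)%E).
  set H := [/\ _, _, _ & _].
  have [h|h] := pselect H; last first.
    by exists set0; split; [split=> // v | move=> /h].
  have [d1 nd vcd [b0 nb c24 c8 ct]] := h.
  have [N [mN PN] NP] := optimal_cost_ge (X_iid d) (mu_sep d) (F_lip d)
    (mu_dist d) vcd nd c24 c8 ct b0 nb (hit_bound p d).
  exists (~` N); split.
    split; first exact: measurableC.
    by move=> v /NP; rewrite /G /= powR_cost_exponent.
  move=> _; rewrite probability_setC//; move: PN.
  rewrite -(@fineK _ (P d N)) ?fin_num_measure//.
  by rewrite -EFinB !lee_fin /bound; lra.
exists (fun d => projT1 (cid (good d))).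
split=> [d|]; first by case: (projT2 (cid (good d))).
(* The choice of [hit_bound] makes [bound d] at most [2^-1 ^+ d]. *)
apply: (@squeeze_cvge _ _ _ _ (fun d => (1 - 4 * 2^-1 ^+ d)%:E) _ (cst 1%E)).
- near=> d.
  have [[mE _] EP] := projT2 (cid (good d)).
  rewrite probability_le1// andbT; apply: le_trans (EP _); last first.
    split; [by near: d; exact: nbhs_infty_gt|by near: d|by near: d|by near: d].
  rewrite lee_fin lerD2l lerN2 ler_pM2l// /bound exprVn.
  have n2 : ((n d).*2.+1)%:R <= 2 ^+ d :> R.
    by near: d; exact: near_2n_le_2X de d_large.
  rewrite ler_pdivrMr ?exprn_gt0// /hit_bound mulnC exprM exprS.
  rewrite mulKf ?expf_neq0//.
  by apply: lerXn2r; rewrite ?nnegrE ?exprn_ge0.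
- apply: cvg_EFin; first exact: nearW.
  rewrite -[X in _ --> X]subr0 -[X in _ - X](mulr0 4).
  apply: cvgB; first exact: cvg_cst.
  apply: cvgMr; apply: cvg_expr; rewrite ger0_norm ?invr_ge0//; lra.
- exact: cvg_cst.
Unshelve. all: by end_near. Qed.
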